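(* Let $d=1$ and $\mathbb{T}=\mathbb{T}^1$. Let $H:\mathbb{T}\times\mathbb{R}\to\mathbb{R}$ be of class $C^1$, with $p\mapsto H(x,p)$ strictly convex for every $x\in\mathbb{T}$, and $\lim_{|p|\to\infty}\inf_{x\in\mathbb{T}}H(x,p)=+\infty$. Let $f:\mathbb{T}\times[0,\infty)\to\mathbb{R}$ be continuous, with $r\mapsto f(x,r)$ strictly increasing for every $x\in\mathbb{T}$, and suppose there is $C>0$ with $|f(x,r)|\le C(1+r^{q-1})$ for all $(x,r)\in\mathbb{T}\times[0,\infty)$. Let $(m,\lambda)$ be an ergodic pair, and let $(u^\varepsilon,m^\varepsilon)_{\varepsilon>0}$ be a family of weak solutions to the discounted problem which satisfies the compactness and stability property. Then the whole family converges as $\varepsilon\to0$: $$\langle u^\varepsilon\rangle\rightharpoonup u_*\quad\text{weakly in }W^{1,s}(\mathbb{T}),$$ where $u_*$ is the unique element of $\mathcal{M}_J$ with $\int_{\mathbb{T}}u_*\,dx=0$.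
   Context: $\mathbb{T}$ is the one-dimensional flat torus, identified with $[0,1]$. Fix $s>1$, $q>1$ with conjugate exponents $s',q'$, and assume the Sobolev embedding $W^{1,s}(\mathbb{T})\hookrightarrow L^{q'}(\mathbb{T})$. Write $\langle u\rangle:=u-\int_{\mathbb{T}}u\,dx$. Weak solutions of the ergodic problem: a triple $(u,m,\lambda)\in W^{1,s}(\mathbb{T})\times L^q(\mathbb{T})\times\mathbb{R}$ is a weak solution to the ergodic problem if (i) $m\ge0$ a.e., $\int_{\mathbb{T}}m\,dx=1$ and $mH_p(x,u_x)\in L^{s'}(\mathbb{T})$; (ii) $H(x,u_x)\le f(x,m)+\lambda$ a.e. on $\mathbb{T}$; (iii) $H(x,u_x)=f(x,m)+\lambda$ a.e. on $\{m>0\}$; (iv) $-(mH_p(x,u_x))_x=0$ in $\mathcal{D}'(\mathbb{T})$. For fixed $(m,\lambda)$, $\mathcal{E}(m,\lambda)$ denotes the set of $u$ such that $(u,m,\lambda)$ is a weak solution. An ergodic pair is a pair $(m,\lambda)\in L^q(\mathbb{T})\times\mathbb{R}$ with $\mathcal{E}(m,\lambda)\neq\emptyset$. Weak solutions of the discounted problem: for $\varepsilon>0$, $(u^\varepsilon,m^\varepsilon)\in W^{1,s}(\mathbb{T})\times L^q(\mathbb{T})$ is a weak solution to the discounted problem if $m^\varepsilon\ge0$ a.e., $\int m^\varepsilon\,dx=1$, $m^\varepsilon H_p(x,u^\varepsilon_x)\in L^{s'}(\mathbb{T})$, $\varepsilon u^\varepsilon+H(x,u^\varepsilon_x)\le f(x,m^\varepsilon)$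 a.e. on $\mathbb{T}$ with equality a.e. on $\{m^\varepsilon>0\}$, and $\varepsilon m^\varepsilon-(m^\varepsilon H_p(x,u^\varepsilon_x))_x=\varepsilon$ in $\mathcal{D}'(\mathbb{T})$. Compactness and stability property of a family $(u^\varepsilon,m^\varepsilon)_{\varepsilon>0}$ of weak solutions to the discounted problem: for every sequence $\varepsilon_n\to0$ there exist a subsequence (not relabeled) and a triple $(\bar u,\bar m,\bar\lambda)\in W^{1,s}(\mathbb{T})\times L^q(\mathbb{T})\times\mathbb{R}$, which is a weak solution to the ergodic problem, such that $\langle u^{\varepsilon_n}\rangle\rightharpoonup\bar u$ weakly in $W^{1,s}(\mathbb{T})$, $m^{\varepsilon_n}\rightharpoonup\bar m$ weakly in $L^q(\mathbb{T})$, and $\varepsilon_n\int_{\mathbb{T}}u^{\varepsilon_n}\,dx\to-\bar\lambda$. Selection functional: for $u\in\mathcal{E}(m,\lambda)$, $J(u):=\int_{\mathbb{T}}\langle u\rangle\,m\,dx$, and $\mathcal{M}_J:=\operatorname*{argmin}_{u\in\mathcal{E}(m,\lambda)}J(u)$. *)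

(* Defs.v *)
From HB Require Import structures.
From mathcomp Require Import all_boot all_order all_algebra.
From mathcomp Require Import all_classical all_reals all_analysis.

Set Implicit Arguments.
Unset Strict Implicit.
Unset Printing Implicit Defensive.
Import Order.TTheory GRing.Theory Num.Theory.
Import numFieldNormedType.Exports.

Local Open Scope classical_set_scope.
Local Open Scope ring_scope.

(* The torus T is R/Z. Continuous objects on T are 1-periodic functions on R.
   Elements of L^p(T) and W^{1,p}(T) are Borel functions on R of which only the
   a.e. class for [torus_measure], the Lebesgue measure carried by the
   fundamental domain [0, 1], matters: no periodicity is asked of them. *)

Section torus_measure.
Context (R : realType).

Definition torus_measure : set (measurableTypeR R) -> \bar R :=
  mrestr lebesgue_measure (measurable_itv (`[0, 1] : interval R)).

HB.instance Definition _ := Measure.on torus_measure.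

Let torus_measure_setT : torus_measure setT = 1%E.
Proof.
rewrite /torus_measure /mrestr setTI lebesgue_measure_itv /= lte_fin ltr01.
by rewrite oppr0 adde0.
Qed.

HB.instance Definition _ :=
  Measure_isProbability.Build _ _ _ torus_measure torus_measure_setT.

End torus_measure.
Arguments torus_measure {R}.

Section torus_functions.
Context {R : realType}.
Implicit Types (u v m phi : R -> R) (s p : R).

Definition periodic1 (T : Type) (g : R -> T) := forall x, g (x + 1) = g x.

Definition inL p u : Prop := u \in Lfun torus_measure p%:E.

Definition normL p u : \bar R := 'N[torus_measure]_(p%:E)[EFin \o u]%E.

Definition test_function phi : Prop :=
  periodic1 phi /\ forall n x, derivable (derive1n n phi) x 1.

Definition weak_derivative u v : Prop :=
  [/\ inL 1 u, inL 1 v &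
    forall phi, test_function phi ->
      \int[torus_measure]_x (u x * derive1 phi x) =
      - \int[torus_measure]_x (v x * phi x)].

(* [grad u] is u_x: the weak derivative, unique up to a.e. equality, when there
   is one, and the zero function otherwise. *)
Definition grad u : R -> R := xget (cst 0) [set v | weak_derivative u v].

Definition inW s u : Prop :=
  inL s u /\ exists2 v, inL s v & weak_derivative u v.

Definition normW s u : \bar R := (normL s u + normL s (grad u))%E.

Definition sobolev_embedding s p : Prop :=
  (forall u, inW s u -> inL p u) /\
  exists K : R, forall u, inW s u -> (normL p u <= K%:E * normW s u)%E.

(* Bounded linear functionals on the space V with (semi)norm N. Boundedness
   makes them insensitive to the choice of an a.e. representative. *)
Definition bounded_functional (V : set (R -> R)) (N : (R -> R) -> \bar R)
    (L : (R -> R) -> R) : Prop :=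
  (forall (a : R) u v, V u -> V v ->
     L (fun x => a * u x + v x) = a * L u + L v) /\
  exists K : R, forall u, V u -> (`|L u|%:E <= K%:E * N u)%E.

Definition weak_cvg (V : set (R -> R)) (N : (R -> R) -> \bar R)
    (I : Type) (F : set_system I) (U : I -> R -> R) (u : R -> R) : Prop :=
  forall L, bounded_functional V N L -> L (U i) @[i --> F] --> L u.

Definition weak_cvgW s := weak_cvg (inW s) (normW s).

Definition weak_cvgL p := weak_cvg (inL p) (normL p).

(* The bracket <u>. *)
Definition centered u : R -> R := fun x => u x - \int[torus_measure]_y u y.

End torus_functions.

Section hamiltonian.
Context {R : realType}.
Implicit Types (H : R -> R -> R) (g : R -> R).

Definition class_C1 (F : R * R -> R) : Prop :=
  (forall z, differentiable F z) /\
  forall v, continuous (fun z => 'd F z v).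

Definition strictly_convex g : Prop :=
  forall p1 p2 t : R, p1 != p2 -> 0 < t < 1 ->
    g (t * p1 + (1 - t) * p2) < t * g p1 + (1 - t) * g p2.

Definition uniformly_coercive H : Prop :=
  let h p := ereal_inf [set (H x p)%:E | x in [set: R]] in
  h p @[p --> +oo] --> +oo%E /\ h p @[p --> -oo] --> +oo%E.

(* The partial derivative H_p. *)
Definition Dp H (x p : R) : R := derive1 (H x) p.

End hamiltonian.

Section mean_field_game.
Context {R : realType}.
Variables (s s' q : R) (H f : R -> R -> R).
Implicit Types (u m : R -> R) (lambda eps : R).

Definition flux u m : R -> R := fun x => m x * Dp H x (grad u x).

Definition ergodic_solution u m lambda : Prop :=
  [/\ inW s u, inL q m,
      [/\ {ae torus_measure, forall x, 0 <= m x},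
          \int[torus_measure]_x m x = 1 & inL s' (flux u m)],
      {ae torus_measure, forall x, H x (grad u x) <= f x (m x) + lambda} /\
      {ae torus_measure, forall x,
        0 < m x -> H x (grad u x) = f x (m x) + lambda} &
      forall phi, test_function phi ->
        \int[torus_measure]_x (flux u m x * derive1 phi x) = 0].

Definition ergodic_set m lambda : set (R -> R) :=
  [set u | ergodic_solution u m lambda].

Definition ergodic_pair m lambda : Prop :=
  inL q m /\ ergodic_set m lambda !=set0.

Definition discounted_solution eps u m : Prop :=
  [/\ inW s u, inL q m,
      [/\ {ae torus_measure, forall x, 0 <= m x},
          \int[torus_measure]_x m x = 1 & inL s' (flux u m)],
      {ae torus_measure, forall x,
        eps * u x + H x (grad u x) <= f x (m x)} /\
      {ae torus_measure, forall x,
        0 < m x -> eps * u x + H x (grad u x) = f x (m x)} &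
      forall phi, test_function phi ->
        \int[torus_measure]_x (eps * m x * phi x) +
        \int[torus_measure]_x (flux u m x * derive1 phi x) =
        \int[torus_measure]_x (eps * phi x)].

(* The families are indexed by all reals; only their values at positive reals
   are used. *)
Definition compact_stable (U M : R -> R -> R) : Prop :=
  forall eps : R^nat, (forall n, 0 < eps n) -> eps n @[n --> \oo] --> 0 ->
  exists k : nat -> nat, {homo k : i j / (i < j)%N} /\
  exists ubar mbar lambdabar,
    [/\ ergodic_solution ubar mbar lambdabar,
        weak_cvgW s \oo (fun n => centered (U (eps (k n)))) ubar,
        weak_cvgL q \oo (fun n => M (eps (k n))) mbar &
        eps (k n) * \int[torus_measure]_x U (eps (k n)) x @[n --> \oo]
          --> - lambdabar].

Definition selection_functional m u : R :=
  \int[torus_measure]_x (centered u x * m x).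

Definition argmin_selection m lambda : set (R -> R) :=
  [set u | ergodic_set m lambda u /\
    forall v, ergodic_set m lambda v ->
      selection_functional m u <= selection_functional m v].

End mean_field_game.

(* Main.v *)
Require Import Defs.
From HB Require Import structures.
From mathcomp Require Import all_boot all_order all_algebra.
From mathcomp Require Import all_classical all_reals all_analysis.
From mathcomp Require Import measurable_realfun.
From mathcomp Require Import ring lra.
Set Implicit Arguments.
Unset Strict Implicit.
Unset Printing Implicit Defensive.
Import Order.TTheory GRing.Theory Num.Theory.
Import numFieldNormedType.Exports.
Local Open Scope classical_set_scope.
Local Open Scope ring_scope.

(** The limit is selected by a duality argument, and it is unique because the
    torus is one-dimensional.

    Selection. Let [(u1, m1)] and [(u2, m2)] solve two of the systems. The
    tangent inequality of the convex function [H x] at the gradient of [u1],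
    weighted by [m1] and integrated, becomes an inequality between integrals of
    [f], [u1] and [u2] ([mfg_duality]): the Hamilton-Jacobi relations replace
    the values of [H], and the transport equation of [m1], tested with
    [u2 - u1], replaces the linear term. Add the inequality for a pair of
    solutions to the one with the pair exchanged; the coupling contributes the
    integral of [(m1 - m2) * (f x m2 - f x m1)], which is nonpositive. For two
    ergodic solutions this forces [m1 = m2], equal constants, and equal
    gradients where [m > 0] ([ergodic_unique]). For a discounted solution [u]
    with density [mu] and an ergodic solution [v], dividing by the discount
    leaves
      [int u * m - int u <= int v * mu - int v]
    ([discounted_selection_le]). Both sides are continuous for the weak
    topologies, so every limit of the family minimises the selection functional
    ([discounted_limit_argmin]).

    Uniqueness. Write [G] for a primitive of [m - 1]. Integration by parts turns
    the selection functional into minus the integral of [G] times the gradient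
    of [u]. Two minimisers have the same gradient where [m > 0]. If their
    gradients differed on a set of positive measure, then by strict convexity
    the Hamilton-Jacobi inequality would be strict there at the midpoint of the
    two, and that midpoint, also a minimiser, could be perturbed by a gradient
    of mean zero supported in such a set; minimality then makes [G] constant on
    a set of positive measure on which [m = 0]. But [G] has derivative [m - 1]
    almost everywhere, and this derivative vanishes almost everywhere on a level
    set of [G] ([primitive_level_ae]): a contradiction
    ([argmin_gradient_room], [argmin_gradient_unique]). A minimiser of mean zero
    is therefore unique, and the compactness of the family upgrades the
    convergence of subsequences to that of the whole family.

    Sobolev functions are handled through primitives. The trigonometric
    polynomials are test functions, and an integrable function orthogonal to all
    of them vanishes ([trig_orthogonal_ae0]); this gives the uniqueness of weak
    derivatives and the lemma of du Bois-Reymond, hence the representation of a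
    function as a constant plus a primitive of its weak derivative, and
    integration by parts for two such functions ([weak_by_parts]). *)

(** * Real functions of one variable *)

Lemma cvg_derive1 (R : numFieldType) (f : R -> R) (x : R) : derivable f x 1 ->
  h^-1 * (f (h + x) - f x) @[h --> 0^'] --> derive1 f x.
Proof.
move=> df; apply: cvg_toP => //.
have <- : (fun h : R => h^-1 *: ((f \o shift x) (h *: 1) - f x)) =
    (fun h => h^-1 * (f (h + x) - f x)); last exact: df.
by apply/funext => h; rewrite /= /GRing.scale /= mulr1.
Qed.

Lemma conjugate_gt1 (R : realFieldType) (p q : R) : 1 < p -> p^-1 + q^-1 = 1 -> 1 < q.
Proof.
move=> p1 pq; have p0 : 0 < p by exact: lt_trans p1.
have pV0 : 0 < p^-1 by rewrite invr_gt0.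
have pV1 : p^-1 < 1 by rewrite invf_lt1.
have q0 : 0 < q by rewrite -invr_gt0; lra.
by rewrite -invf_lt1//; lra.
Qed.

Section convexity.
Context {R : realType}.
Implicit Types (g : R -> R) (p a b t : R).

(** By convexity, the increments of [g] over the steps [(p2 - p1) / (n + 2)],
    multiplied by [n + 2], stay below [g p2 - g p1]. *)
Lemma tangent_le g p1 p2 : strictly_convex g -> derivable g p1 1 ->
  derive1 g p1 * (p2 - p1) <= g p2 - g p1.
Proof.
move=> gcvx dg; have [->|p12] := eqVneq p2 p1; first by rewrite !subrr mulr0.
set d := p2 - p1; have d0 : d != 0 by rewrite subr_eq0.
pose h n := d * n.+2%:R^-1 : R.
have h0 n : h n != 0 by rewrite mulf_neq0// invr_eq0 pnatr_eq0.
have hcvg : h n @[n --> \oo] --> (0 : R).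
  rewrite -(mulr0 d); apply: cvgM; first exact: cvg_cst.
  by have := @cvg_harmonic R; rewrite -cvg_shiftS.
have := (cvgr_dnbhsP _ _ _).1 (cvg_derive1 dg) h (conj h0 hcvg) => qcvg.
have {}qcvg : (h n)^-1 * (g (h n + p1) - g p1) * d @[n --> \oo] --> derive1 g p1 * d.
  by apply: cvgM => //; exact: cvg_cst.
rewrite -(cvg_lim (@Rhausdorff R) qcvg); apply: limr_le; first exact: cvgP qcvg.
apply: nearW => n; pose t : R := n.+2%:R^-1.
have t0 : 0 < t by rewrite invr_gt0.
have t1 : t < 1 by rewrite invf_lt1// ltr1n.
have := gcvx p2 p1 t p12; rewrite t0 t1 => /(_ isT).
rewrite (_ : t * p2 + (1 - t) * p1 = h n + p1); last by rewrite /h -/t /d; ring.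
move=> gt; rewrite (_ : _ * d = (g (h n + p1) - g p1) / t); last first.
  by rewrite /h -/t; field; rewrite d0 gt_eqF.
by rewrite ler_pdivrMr//; lra.
Qed.

(** Strictness comes from the tangent inequality at the midpoint. *)
Lemma tangent_lt g p1 p2 : strictly_convex g -> derivable g p1 1 -> p1 != p2 ->
  derive1 g p1 * (p2 - p1) < g p2 - g p1.
Proof.
move=> gcvx dg p12; have := tangent_le (2^-1 * p1 + (1 - 2^-1) * p2) gcvx dg.
have := gcvx p1 p2 2^-1 p12; rewrite invr_gt0 ltr0n invf_lt1// ltr1n => /(_ isT).
by move: (g _) (derive1 g p1) => *; nra.
Qed.

Lemma convex_le_between g p1 p2 t : strictly_convex g -> 0 <= t <= 1 ->
  g (t * p1 + (1 - t) * p2) <= t * g p1 + (1 - t) * g p2.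
Proof.
move=> gcvx /andP[t0 t1].
have [->|p12] := eqVneq p1 p2.
  by rewrite (_ : t * p2 + _ = p2); [lra|ring].
move: t0 t1; rewrite le_eqVlt => /predU1P[<-|t0].
  by rewrite !mul0r !add0r subr0 !mul1r.
rewrite le_eqVlt => /predU1P[->|t1].
  by rewrite subrr !mul0r !addr0 !mul1r.
by apply/ltW/gcvx => //; rewrite t0.
Qed.
End convexity.

Section step_approximation.
Context {R : realType}.
Implicit Types (t y : R) (n : nat).

Lemma bernoulli_ge t n : -1 <= t -> 1 + n%:R * t <= (1 + t) ^+ n.
Proof.
move=> t1; elim: n => [|n ih]; first by rewrite mul0r addr0 expr0.
rewrite exprS; apply: (@le_trans _ _ ((1 + t) * (1 + n%:R * t))).
  rewrite -natr1 -subr_ge0.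
  rewrite (_ : _ - _ = n%:R * t ^+ 2); last by ring.
  by rewrite mulr_ge0// sqr_ge0.
by rewrite ler_wpM2l//; lra.
Qed.

(** Together with [cvg_step_gt]: as [n] grows, the polynomials
    [(1 - y ^ n) ^ (2 ^ n)] approach on [[0, 1]] the step that jumps from 1 to 0
    at [y = 1 / 2]. By Bernoulli's inequality they lie within [(2 y) ^ n] of 1. *)
Lemma cvg_step_lt y : 0 <= y -> 2 * y < 1 ->
  (1 - y ^+ n) ^+ (2 ^ n) @[n --> \oo] --> (1 : R).
Proof.
move=> y0 y1; have yX n : 0 <= y ^+ n <= 1 by rewrite exprn_ge0// exprn_ile1//; lra.
apply: (@squeeze_cvgr _ _ _ _ (fun n => 1 - (2 * y) ^+ n) (cst 1)).
- apply: nearW => n; have /andP[yn0 yn1] := yX n; apply/andP; split.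
    have := @bernoulli_ge (- y ^+ n) (2 ^ n); rewrite mulrN natrX -exprMn.
    by apply; lra.
  by rewrite exprn_ile1//; lra.
- rewrite -[X in _ --> X]subr0; apply: cvgB; first exact: cvg_cst.
  by apply: cvg_expr; rewrite ger0_norm// mulr_ge0.
- exact: cvg_cst.
Qed.

(** Multiplied by [(1 + y ^ n) ^ (2 ^ n)], which exceeds [(2 y) ^ n] by
    Bernoulli's inequality, the polynomial stays below 1. *)
Lemma cvg_step_gt y : y <= 1 -> 1 < 2 * y ->
  (1 - y ^+ n) ^+ (2 ^ n) @[n --> \oo] --> (0 : R).
Proof.
move=> y1 y2; have yX n : 0 <= y ^+ n <= 1 by rewrite exprn_ge0 ?exprn_ile1//; lra.
apply: (@squeeze_cvgr _ _ _ _ (cst 0) (fun n => ((2 * y)^-1) ^+ n)).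
- apply: nearW => n; have /andP[yn0 yn1] := yX n; apply/andP; split.
    by rewrite exprn_ge0//; lra.
  rewrite exprVn -[leRHS]mul1r ler_pdivlMr ?exprn_gt0//; last by lra.
  have := @bernoulli_ge (y ^+ n) (2 ^ n); rewrite natrX -exprMn => b.
  apply: (@le_trans _ _ ((1 - y ^+ n) ^+ (2 ^ n) * (1 + y ^+ n) ^+ (2 ^ n))).
    apply: ler_wpM2l; first by rewrite exprn_ge0//; lra.
    by apply: le_trans (b _); lra.
  rewrite -exprMn -subr_sqr expr1n exprn_ile1//.
    by rewrite subr_ge0 exprn_ile1.
  by rewrite lerBlDr lerDl exprn_ge0.
- exact: cvg_cst.
- by apply: cvg_expr; rewrite ger0_norm ?invr_ge0 ?invf_lt1//; lra.
Qed.
End step_approximation.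

(** * Integrals and almost everywhere comparison *)

Section almost_everywhere_integrals.
Context d (T : measurableType d) (R : realType).
Variable mu : {measure set T -> \bar R}.
Implicit Types f g h : T -> R.
Local Notation int f := (mu.-integrable setT (EFin \o f)).

Lemma integrable_measurable f : int f -> measurable_fun setT f.
Proof. by move=> /measurable_int /measurable_EFinP. Qed.

Lemma integrable_add f g : int f -> int g -> int (fun x => f x + g x).
Proof. by move=> fi gi; exact: (integrableD measurableT fi gi). Qed.

Lemma integrable_sub f g : int f -> int g -> int (fun x => f x - g x).
Proof. by move=> fi gi; exact: (integrableB measurableT fi gi). Qed.

Lemma integrable_scale (a : R) f : int f -> int (fun x => a * f x).
Proof. by move=> fi; exact: (integrableZl measurableT a fi). Qed.

Lemma integrable_scaler (a : R) f : int f -> int (fun x => f x * a).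
Proof.
move=> fi; have := integrable_scale a fi.
by rewrite (_ : (fun x => a * f x) = fun x => f x * a)//; apply/funext => x; rewrite mulrC.
Qed.

Lemma integrable_ae_dominated f g : measurable_fun setT f -> int g ->
  {ae mu, forall x, `|f x| <= `|g x|} -> int f.
Proof.
move=> mf gi fg; have mg := integrable_measurable gi.
apply/integrableP; split; first exact/measurable_EFinP.
have /integrableP[_] := gi; apply: le_lt_trans.
apply: ae_ge0_le_integral => //.
- by do 2 apply: measurableT_comp => //.
- by do 2 apply: measurableT_comp => //.
- by apply: filterS fg => x fgx _; rewrite lee_fin.
Qed.

Lemma integrable_ae_eq f g : measurable_fun setT g -> int f ->
  {ae mu, forall x, f x = g x} -> int g.
Proof.
move=> mg fi fg; apply: (integrable_ae_dominated mg fi).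
by apply: filterS fg => x ->.
Qed.

Lemma integrable_mul_ae_bounded f g (K : R) : int f -> measurable_fun setT g ->
  {ae mu, forall x, `|g x| <= K} -> int (fun x => f x * g x).
Proof.
move=> fi mg gK; have mf := integrable_measurable fi.
apply: (integrable_ae_dominated _ (integrable_scale K fi)).
  exact: measurable_funM.
apply: filterS gK => x gK; rewrite !normrM mulrC ler_wpM2r//.
by rewrite (le_trans gK)// ler_norm.
Qed.

Lemma ae_eq_Rintegral f g : measurable_fun setT f -> measurable_fun setT g ->
  {ae mu, forall x, f x = g x} -> \int[mu]_x f x = \int[mu]_x g x.
Proof.
move=> mf mg fg; congr fine; apply: ae_eq_integral => //.
- exact/measurable_EFinP.
- exact/measurable_EFinP.
- by apply: filterS fg => x -> _.
Qed.

Lemma ae_le_Rintegral f g : int f -> int g ->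
  {ae mu, forall x, f x <= g x} -> \int[mu]_x f x <= \int[mu]_x g x.
Proof.
move=> fi gi fg; rewrite -subr_ge0 -RintegralB//.
have mgf := integrable_measurable (integrable_sub gi fi).
rewrite (_ : \int[mu]_x _ = \int[mu]_x `|g x - f x|); first exact: Rintegral_ge0.
apply: ae_eq_Rintegral => //; first exact: measurableT_comp.
by apply: filterS fg => x fgx; rewrite ger0_norm// subr_ge0.
Qed.

Lemma Rintegral_le0_ae_eq0 f : int f -> {ae mu, forall x, 0 <= f x} ->
  \int[mu]_x f x <= 0 -> {ae mu, forall x, f x = 0}.
Proof.
move=> fi f0 If; have mf := integrable_measurable fi.
have mnf : measurable_fun setT (fun x => `|f x|) by exact: measurableT_comp.
have If0 : \int[mu]_x `|f x| = 0.
  apply/eqP; rewrite eq_le Rintegral_ge0// andbT (le_trans _ If)//.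
  rewrite (ae_eq_Rintegral mnf mf)//.
  by apply: filterS f0 => x; exact: ger0_norm.
have : (\int[mu]_x `|(EFin \o f) x| = 0)%E.
  rewrite -[LHS]fineK; last exact: (integrable_fin_num measurableT (integrable_norm fi)).
  by rewrite [fine _]If0.
move=> /(ae_eq_integral_abs mu measurableT (measurable_int mu fi)).
by apply: filterS => x /(_ I)[].
Qed.

End almost_everywhere_integrals.

Section finite_measure_integrals.
Context d (T : measurableType d) (R : realType).
Variable mu : {finite_measure set T -> \bar R}.
Local Notation int f := (mu.-integrable setT (EFin \o f)).

Lemma integrable_cst (a : R) : int (cst a).
Proof. exact: (finite_measure_integrable_cst mu a measurableT). Qed.

Lemma integrable_ae_bounded (g : T -> R) (K : R) : measurable_fun setT g ->
  {ae mu, forall x, `|g x| <= K} -> int g.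
Proof.
move=> mg gK; apply: (integrable_ae_dominated mg (integrable_cst K)).
by apply: filterS gK => x gK; rewrite (le_trans gK)// ler_norm.
Qed.

End finite_measure_integrals.

Section superposition.
Context d (T : measurableType d) (R : realType).
(** The function [F] is regular in each variable separately, so [g] is
    approximated by step functions, on whose level sets only sections of [F]
    with a fixed second argument occur. *)
Lemma measurable_caratheodory (F : T -> R -> R) (g : T -> R) :
  (forall r, measurable_fun setT (F^~ r)) -> (forall x, continuous (F x)) ->
  measurable_fun setT g -> measurable_fun setT (fun x => F x (g x)).
Proof.
move=> mF cF mg.
pose a n x : R := (Num.floor (g x * n.+1%:R))%:~R / n.+1%:R.
apply: (@measurable_fun_cvg _ _ _ _ (fun n x => F x (a n x))) => [n|x _]; last first.
  apply: continuous_cvg; first exact: cF.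
  apply: (@squeeze_cvgr _ _ _ _ (fun n => g x - n.+1%:R^-1) (cst (g x))).
  - apply: nearW => n; have := floor_itv (g x * n.+1%:R) => /andP[f1 f2].
    rewrite /a ler_pdivrMr ?ltr0Sn// f1 andbT ler_pdivlMr ?ltr0Sn// mulrBl mulVf ?pnatr_eq0//.
    by rewrite lerBlDr -intrD1 ltW.
  - rewrite -[X in _ --> X]subr0; apply: cvgB; first exact: cvg_cst.
    exact: cvg_harmonic.
  - exact: cvg_cst.
move=> _ B mB; rewrite setTI.
have mh : measurable_fun setT (fun x => g x * n.+1%:R) by exact: measurable_funM.
rewrite (_ : _ @^-1` _ = \bigcup_(k in [set: int])
    ((fun x => F x (k%:~R / n.+1%:R)) @^-1` B `&`
     (fun x => g x * n.+1%:R) @^-1` `[k%:~R, (k + 1)%:~R[ )); last first.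
  apply/seteqP; split => [x Bx|x [k _ [Bx]]].
    exists (Num.floor (g x * n.+1%:R)) => //; split => //.
    by rewrite /= in_itv /= floor_itv.
  by rewrite /= in_itv /= => /floor_def kE; rewrite /a kE.
apply: countable_bigcupT_measurable => // k; apply: measurableI.
  by rewrite -[X in measurable X]setTI; exact: mF.
by rewrite -[X in measurable X]setTI; apply: mh.
Qed.
End superposition.

(** * Trigonometric polynomials *)

Section trigonometric_polynomials.
Context {R : realType}.
Implicit Types (f g h phi : R -> R) (A b c x : R) (k : int).

(** The phase [b] makes the family stable under derivatives and antiderivatives:
    both only shift it by a quarter of a turn. *)
Definition wave A k b : R -> R := fun x => A * cos (2 * pi * k%:~R * x + b).

Inductive trigpoly : (R -> R) -> Prop :=
| trigpoly_wave A k b : trigpoly (wave A k b)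
| trigpolyD f g : trigpoly f -> trigpoly g -> trigpoly (fun x => f x + g x).

Lemma cosDint (k : int) x : cos (x + 2 * pi * k%:~R) = cos x.
Proof.
have cosDnat n (z : R) : cos (z + 2 * pi * n%:R) = cos z.
  by rewrite -[RHS](periodicn (@cosD2pi R) n) mulr_natr mulr_natl.
case: k => n; first exact: cosDnat.
by rewrite NegzE intrN mulrN -(cosDnat n.+1) subrK.
Qed.

Lemma wave_periodic A k b : periodic1 (wave A k b).
Proof.
move=> x; rewrite /wave -(cosDint k (_ * x + b)); congr (_ * cos _).
by rewrite mulrDr mulr1 addrAC.
Qed.

Lemma is_derive_wave A k b x :
  is_derive x (1 : R) (wave A k b) (wave (A * (2 * pi * k%:~R)) k (b + pi / 2) x).
Proof.
rewrite /wave addrA cosDpihalf.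
have d1 : is_derive x (1 : R) (fun y : R => 2 * pi * k%:~R * y + b) (2 * pi * k%:~R).
  have := is_deriveD (is_deriveZ (2 * pi * k%:~R) (is_derive_id x (1 : R)))
    (is_derive_cst b x (1 : R)).
  by rewrite addr0 /GRing.scale /= mulr1.
have dc := is_deriveZ A (@is_derive1_comp R cos _ x _ _ (is_derive_cos _) d1).
apply: (is_derive_eq dc).
by rewrite /GRing.scale /=; ring.
Qed.

Lemma is_derive_trigpoly h : trigpoly h ->
  exists2 h', trigpoly h' & forall x, is_derive x (1 : R) h (h' x).
Proof.
elim=> [A k b|f g _ [f' tf' df] _ [g' tg' dg]].
  exists (wave (A * (2 * pi * k%:~R)) k (b + pi / 2)); first exact: trigpoly_wave.
  by move=> x; exact: is_derive_wave.
exists (fun x => f' x + g' x); first exact: trigpolyD.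
by move=> x; exact: is_deriveD.
Qed.

Lemma trigpoly_derive1 h : trigpoly h ->
  trigpoly (derive1 h) /\ forall x, derivable h x 1.
Proof.
move=> /is_derive_trigpoly[h' th' dh]; split=> [|x]; last exact: ex_derive.
suff -> : derive1 h = h' by [].
by apply/funext => x; rewrite derive1E derive_val.
Qed.

Lemma trigpoly_periodic h : trigpoly h -> periodic1 h.
Proof.
elim=> [A k b|f g _ pf _ pg x]; first exact: wave_periodic.
by rewrite pf pg.
Qed.

Lemma trigpoly_test h : trigpoly h -> test_function h.
Proof.
move=> th; split; first exact: trigpoly_periodic.
move=> n x; suff : trigpoly (derive1n n h) by case/trigpoly_derive1.
by elim: n => //= n /trigpoly_derive1[].
Qed.

Lemma trigpolyZ A h : trigpoly h -> trigpoly (fun x => A * h x).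
Proof.
elim=> [B k b|f g _ tf _ tg].
  rewrite (_ : (fun _ => _) = wave (A * B) k b); first exact: trigpoly_wave.
  by apply/funext => x; rewrite /wave mulrA.
under eq_fun do rewrite mulrDr; exact: trigpolyD.
Qed.

Lemma trigpoly_cst A : trigpoly (cst A).
Proof.
rewrite (_ : cst A = wave A 0 0); first exact: trigpoly_wave.
by apply/funext => x; rewrite /wave /= mulr0 mul0r addr0 cos0 mulr1.
Qed.

Lemma trigpolyM f g : trigpoly f -> trigpoly g -> trigpoly (fun x => f x * g x).
Proof.
move=> tf tg; elim: tf => [A k b|f1 f2 _ t1 _ t2]; last first.
  by under eq_fun do rewrite mulrDl; exact: trigpolyD.
elim: tg => [B l c|g1 g2 _ t1 _ t2]; last first.
  by under eq_fun do rewrite mulrDr; exact: trigpolyD.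
(* By the product-to-sum formula, the frequencies add up and subtract. *)
rewrite (_ : (fun _ => _) = fun x => wave (A * B / 2) (k + l) (b + c) x +
    wave (A * B / 2) (k - l) (b - c) x).
  by apply: trigpolyD; exact: trigpoly_wave.
apply/funext => x; rewrite /wave intrD intrB.
rewrite (_ : _ * x + (b + c) = (2 * pi * k%:~R * x + b) + (2 * pi * l%:~R * x + c)); last by ring.
rewrite (_ : _ * x + (b - c) = (2 * pi * k%:~R * x + b) - (2 * pi * l%:~R * x + c)); last by ring.
set P := 2 * pi * k%:~R * x + b; set Q := 2 * pi * l%:~R * x + c.
by rewrite (cosD P Q) (cosB P Q); field.
Qed.

Lemma trigpolyX n h : trigpoly h -> trigpoly (fun x => h x ^+ n).
Proof.
move=> th; elim: n => [|n ih]; first exact: trigpoly_cst.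
by under eq_fun do rewrite exprS; exact: trigpolyM.
Qed.

(** Only the constant term of a trigonometric polynomial has no periodic
    antiderivative. *)
Lemma trigpoly_primitive h : trigpoly h ->
  exists phi c, test_function phi /\ h = fun x => derive1 phi x + c.
Proof.
elim=> [A k b|f g _ [phi [c [tphi ->]]] _ [psi [e [tpsi ->]]]].
  have [->|k0] := eqVneq k 0.
    exists (cst 0), (A * cos b); split; first exact/trigpoly_test/trigpoly_cst.
    apply/funext => x; rewrite derive1_cst add0r /wave.
    by rewrite mulr0 mul0r add0r.
  have w0 : 2 * pi * k%:~R != 0 :> R.
    rewrite mulf_neq0 ?intr_eq0// mulf_neq0 ?pnatr_eq0// gt_eqF//; exact: pi_gt0.
  exists (wave (A / (2 * pi * k%:~R)) k (b - pi / 2)), 0; split.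
    exact/trigpoly_test/trigpoly_wave.
  apply/funext => x; rewrite derive1E.
  have dw := is_derive_wave (A / (2 * pi * k%:~R)) k (b - pi / 2) x.
  by rewrite derive_val mulfVK// subrK addr0.
have dphi x : derivable phi x 1 by have [_ /(_ 0%N x)] := tphi.
have dpsi x : derivable psi x 1 by have [_ /(_ 0%N x)] := tpsi.
exists (fun x => phi x + psi x), (c + e); split.
  split=> [x|n x]; first by have [[-> _] [-> _]] := (tphi, tpsi).
  suff -> : derive1n n (fun x => phi x + psi x) =
            fun x => derive1n n phi x + derive1n n psi x.
    exact: derivableD (tphi.2 n x) (tpsi.2 n x).
  elim: n => // n ih; rewrite /= ih; apply/funext => y.
  rewrite !derive1E; exact: deriveD (tphi.2 n y) (tpsi.2 n y).
apply/funext => x; rewrite addrACA; congr (_ + _).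
by rewrite !derive1E; symmetry; exact: deriveD (dphi x) (dpsi x).
Qed.
End trigonometric_polynomials.

(** * Primitives on the torus *)

#[global] Instance torus_ae_filter (R : realType) :
  Filter (nbhs (almost_everywhere (@torus_measure R))).
Proof. exact: ae_filter_ringOfSetsType. Qed.

Local Notation torus := torus_measure.
Local Notation int f := (torus.-integrable setT (EFin \o f)).
Local Notation meas f := (measurable_fun (setT : set (measurableTypeR _)) f).

Section primitives.
Context {R : realType}.
Local Notation leb := (@lebesgue_measure R).
Local Notation I01 := (`[0%R, 1%R]%classic : set R).
Implicit Types (f g h phi : R -> R) (x y t : R).

Lemma torus_measureE (A : set R) : torus A = leb (A `&` I01).
Proof. by []. Qed.

Lemma torus_setT : @torus_measure R setT = 1%E.
Proof. exact: probability_setT. Qed.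

Lemma integral_torus_cst (a : R) : \int[torus]_x a = a.
Proof. by rewrite Rintegral_cst// [X in fine X]torus_setT mulr1. Qed.

Lemma ae_torus01 : {ae torus, forall x, 0 <= x <= 1}.
Proof.
exists (~` I01); split; first exact: measurableC.
  by rewrite [LHS]torus_measureE setICl measure0.
by move=> x /= + x01; apply; move: x01; rewrite in_itv.
Qed.

Lemma ae_torus (P : R -> Prop) :
  {ae torus, forall x, P x} <-> {ae leb, forall x, 0 <= x <= 1 -> P x}.
Proof.
split=> [[N [mN N0 PN]]|[N [mN N0 PN]]].
  exists (N `&` I01); split => //; first exact: measurableI.
  move=> x /= /not_implyP[x01 nPx]; split; last by rewrite in_itv.
  exact: PN.
have N01 : {ae torus, forall x, 0 <= x <= 1 -> P x}; last first.
  by apply: filterS2 ae_torus01 N01 => x x01; exact.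
exists N; split => //.
apply/eqP; rewrite eq_le measure_ge0 andbT -N0 [leLHS]torus_measureE.
by apply: le_measure; rewrite ?inE//; exact: measurableI.
Qed.

Lemma integral_torus (D : set R) (f : R -> \bar R) : measurable D ->
  measurable_fun setT f ->
  (\int[torus]_(x in D) f x = \int[leb]_(x in D `&` I01) f x)%E.
Proof.
move=> mD mf.
have mD1 : measurable (D `&` I01) by exact: measurableI.
have mD2 : measurable (D `\` I01) by exact: measurableD.
rewrite -{1}(setUIDK D I01) integral_setU//; last 2 first.
  exact: measurable_funTS.
  by apply/disj_setPS => x [[_ ?] [_]].
rewrite [X in (_ + X)%E](_ : _ = 0%E) ?adde0; last first.
  apply: null_set_integral => //; first exact: measurable_funTS.
  rewrite [LHS]torus_measureE.
  by rewrite setDE -setIA setICl setI0 measure0.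
apply: eq_measure_integral => A mA AD; rewrite /= /torus_measure /mrestr.
by rewrite [A `&` _]setIidl// => x /AD[].
Qed.

(** On [[0, 1]] this is the integral of [g] from [0] to [x]; the ray, rather than
    an interval, leaves a single indicator for Fubini's theorem to exchange. *)
Definition primitive g x : R := \int[torus]_t (\1_(`]-oo, x]) t * g t).

Lemma integrable_ray g x : int g -> int (fun t => \1_(`]-oo, x]) t * g t).
Proof.
move=> gi; have mg := integrable_measurable gi.
have m1 : measurable_fun setT (\1_(`]-oo, x]) : R -> R) by exact: measurable_indic.
apply: (integrable_ae_dominated _ gi); first exact: measurable_funM.
apply: aeW => t; rewrite indicE normrM ler_piMl//.
by case: (_ \in _); rewrite ?normr1 ?normr0.
Qed.

Lemma primitive_le g x : int g -> `|primitive g x| <= \int[torus]_t `|g t|.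
Proof.
move=> gi; apply: (le_trans (le_normr_Rintegral measurableT (integrable_ray x gi))).
apply: ae_le_Rintegral; [exact: integrable_norm (integrable_ray x gi)|exact: integrable_norm|].
apply: aeW => t; rewrite indicE normrM ler_piMl//.
by case: (_ \in _); rewrite ?normr1 ?normr0.
Qed.

Lemma primitive_lebesgue g x : int g ->
  primitive g x = \int[leb]_(t in `]-oo, x]) (g \_ I01) t.
Proof.
move=> gi; rewrite /primitive /Rintegral integral_torus//; last first.
  exact: measurable_int (integrable_ray x gi).
congr fine; rewrite setTI [LHS]integral_mkcond [RHS]integral_mkcond.
apply: eq_integral => t _; rewrite !patchE indicE.
by do 2 case: ifPn => //= _; rewrite ?mul1r ?mul0r.
Qed.

Lemma integrable_lebesgue_restrict g : int g -> leb.-integrable setT (EFin \o (g \_ I01)).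
Proof.
move=> gi; have mg := integrable_measurable gi.
have mI : measurable I01 by [].
rewrite -restrict_EFin -integrable_restrict//.
rewrite setTI; apply/integrableP; split; first exact/measurable_funTS/measurable_EFinP.
have /integrableP[_] := gi; rewrite integral_torus//; last first.
  by do 2 apply: measurableT_comp => //.
by rewrite setTI.
Qed.

(** Almost every point is a Lebesgue point of [g], where the primitive has
    derivative [g x]; if [g x != 0], such a point is isolated in the level set,
    and the isolated points of a set of reals are countable. *)
Lemma primitive_level_ae g (c : R) : int g ->
  {ae torus, forall x, primitive g x = c -> g x = 0}.
Proof.
move=> gi; apply/ae_torus.
have gi1 := integrable_lebesgue_restrict gi.
pose F x := \int[leb]_(t in `]-oo, x]) (g \_ I01) t.
have FE : primitive g = F by apply/funext => x; exact: primitive_lebesgue.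
have FTC : {ae leb, forall x, derivable F x 1 /\ derive1 F x = (g \_ I01) x}.
  apply: FTC1Ny => [y|]; first exact: integrableS gi1.
  exact: open_integrable_locally openT gi1.
pose S n := [set x | F x = c /\ forall y, 0 < `|y - x| < n.+1%:R^-1 -> F y != c].
have cS n : countable (S n).
  apply/countable_injP.
  exists (fun x => pickle (Num.floor (x * n.+1%:R))) => x y.
  rewrite !inE => -[Fx xS] [Fy _] /(pcan_inj pickleK) xy.
  apply/eqP/negPn/negP => xNy; move: (xS y); rewrite Fy eqxx => /implyP.
  rewrite implybF => /negP; apply; apply/andP; split.
    by rewrite normr_gt0 subr_eq0 eq_sym.
  rewrite -(ltr_pM2r (ltr0Sn R n)) mulVf ?pnatr_eq0// -[X in _ * X]gtr0_norm//.
  rewrite -normrM mulrBl.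
  have := floor_itv (x * n.+1%:R); have := floor_itv (y * n.+1%:R).
  rewrite xy intrD => /andP[y1 y2] /andP[x1 x2].
  by rewrite ltr_norml; lra.
have SN : leb.-negligible (\bigcup_n S n).
  apply: negligible_bigcup => n; apply/negligibleP.
    exact: countable_measurable.
  exact: countable_lebesgue_measure0.
have aeS : {ae leb, forall x, ~ (\bigcup_n S n) x}.
  by move: SN => [N [mN N0 SN]]; exists N; split=> // x /= /contrapT/SN.
have aef : Filter (nbhs (almost_everywhere leb)).
  exact: ae_filter_ringOfSetsType.
apply: filterS2 FTC aeS => x [dF F'x] nSx x01; rewrite FE => Fxc.
apply/eqP/negPn/negP => gx0; apply: nSx.
have {}F'x : derive1 F x = g x.
  by rewrite F'x patchE ifT// inE /= in_itv.
have := cvg_derive1 dF; rewrite F'x => /cvgr_neq0 /(_ gx0).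
move=> [e /= e0 he].
have [n ne] : exists n, n.+1%:R^-1 < e.
  exists (Num.truncn e^-1); rewrite invf_plt ?posrE ?ltr0Sn//.
  by rewrite truncnS_gt.
exists n => //; split=> // y /andP[yx0 yxn]; apply/eqP => Fyc.
have yxe : `|0 - (y - x)| < e by rewrite sub0r normrN (lt_trans yxn ne).
have yx : y - x != 0 by rewrite -normr_gt0.
by have := he (y - x) yxe yx; rewrite subrK Fyc Fxc subrr mulr0 eqxx.
Qed.

Lemma indic_ray (x t : R) : \1_(`]-oo, x]) t = (t <= x)%R%:R :> R.
Proof. by rewrite indicE mem_setE in_itv. Qed.

(* The integrand [g t * h x], cut off along the diagonal of the unit square. *)
Let K g h : R * R -> \bar R := fun z => ((z.1 <= z.2)%R%:R * (g z.1 * h z.2))%:E.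

Let measurable_K g h : meas g -> meas h ->
  measurable_fun setT (K g h).
Proof.
move=> mg mh; apply/measurable_EFinP; apply: measurable_funM; last first.
  by apply: measurable_funM; exact: measurableT_comp.
pose A := [set z : R * R | z.1 <= z.2].
rewrite (_ : (fun _ => _) = (\1_A : R * R -> R)); last first.
  apply/funext => z; rewrite indicE; congr (nat_of_bool _)%:R.
  by apply/idP/idP; rewrite inE.
apply: measurable_indic.
rewrite (_ : A = setT `&` (fun z : R * R => z.1 <= z.2) @^-1` [set true]); last first.
  by apply/seteqP; split => z //= [].
exact: measurable_fun_ler measurable_fst measurable_snd _ _ _.
Qed.

Let integrable_K g h : int g -> int h -> (torus \x torus)%E.-integrable setT (K g h).
Proof.
move=> gi hi; have mg := integrable_measurable gi; have mh := integrable_measurable hi.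
apply/integrable12ltyP; first exact: measurable_K.
have /integrableP[_ gy] := gi; have /integrableP[_ hy] := hi.
have mng : measurable_fun setT (fun x => `|(g x)%:E|%E).
  by do 2 apply: measurableT_comp => //.
have mnh : measurable_fun setT (fun x => `|(h x)%:E|%E).
  by do 2 apply: measurableT_comp => //.
apply: (@le_lt_trans _ _ (\int[torus]_x (`|(g x)%:E| * \int[torus]_y `|(h y)%:E|))%E).
  apply: ge0_le_integral => //.
  - by move=> x _; exact: integral_ge0.
  - have mK : measurable_fun setT (abse \o K g h).
      by apply: measurableT_comp => //; exact: measurable_K.
    exact: (@measurable_fun_fubini_tonelli_F _ _ _ _ R torus _ mK (fun=> abse_ge0 _)).
  - by apply: emeasurable_funM.
  move=> x _; rewrite -ge0_integralZl//.
  apply: ge0_le_integral => //.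
  - apply: measurableT_comp => //; apply: measurableT_comp (measurable_K mg mh) _ => //.
  - by apply: emeasurable_funM.
  move=> y _; rewrite -abseM lee_fin /= !normrM ler_piMl//.
  by case: (x <= y); rewrite ?normr1 ?normr0.
rewrite ge0_integralZr//.
  by rewrite lte_mul_pinfty ?integral_ge0// ge0_fin_numE ?integral_ge0.
exact: integral_ge0.
Qed.

Let integral_K1 g h x : int g ->
  (\int[torus]_t K g h (t, x) = (primitive g x * h x)%:E)%E.
Proof.
move=> gi; have := integrable_ray x gi => gx.
rewrite -RintegralZr// /Rintegral fineK; last first.
  apply: (integrable_fin_num measurableT).
  exact: integrable_scaler.
by apply: eq_integral => t _; rewrite /K /= indic_ray mulrA.
Qed.

Lemma measurable_primitive g : int g -> meas (primitive g).
Proof.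
move=> gi; have i1 : int (cst (1 : R)) by exact: integrable_cst.
apply/measurable_EFinP.
have := measurable_fubini_G (integrable_K gi i1).
rewrite /fubini_G; congr measurable_fun; apply/funext => x.
by rewrite integral_K1//= mulr1.
Qed.

Lemma ae_neq (x : R) : {ae torus, forall y, y != x}.
Proof.
apply/ae_torus; exists [set x]; split => //; first exact: lebesgue_measure_set1.
by move=> y /= /not_implyP[_ /negP/negPn/eqP].
Qed.

Lemma primitive0 g : int g -> primitive g 0 = 0.
Proof.
move=> gi; transitivity (\int[torus]_x (cst 0 x : R)); last first.
  by rewrite Rintegral_cst// mul0r.
apply: ae_eq_Rintegral => //; first exact: integrable_measurable (integrable_ray 0 gi).
apply: filterS2 ae_torus01 (ae_neq 0) => t /andP[t0 _] tn0.
by rewrite indic_ray leNgt lt_neqAle eq_sym tn0 t0 mul0r.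
Qed.

Let integral_K2 g h t : int g -> int h ->
  (\int[torus]_x K g h (t, x) = (g t * (\int[torus]_x h x - primitive h t))%:E)%E.
Proof.
move=> gi hi; have mg := integrable_measurable gi; have mh := integrable_measurable hi.
have ih := integrable_ray t hi.
rewrite -RintegralB// -RintegralZl//; last exact: integrable_sub.
rewrite /Rintegral fineK; last first.
  apply: (integrable_fin_num measurableT); apply: integrable_scale; exact: integrable_sub.
apply: ae_eq_integral => //.
- by apply: measurableT_comp (measurable_K mg mh) _ => //.
- apply/measurable_EFinP. exact: integrable_measurable (integrable_scale _ (integrable_sub hi ih)).
apply: filterS (ae_neq t) => x xt _; rewrite /K /= indic_ray.
congr _%:E; case: (ltgtP t x) xt => [tx|tx|-> /eqP//] _.
- by rewrite mul0r subr0 mul1r.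
- by rewrite mul1r mul0r subrr mulr0.
Qed.

Lemma integrable_mul_primitive g h : int g -> int h -> int (fun x => g x * primitive h x).
Proof.
move=> gi hi; apply: (integrable_mul_ae_bounded gi (measurable_primitive hi)).
by apply: aeW => x; exact: primitive_le.
Qed.

(** Integration by parts for absolutely continuous functions, by Fubini's
    theorem: both sides integrate [g t * h x] over the unit square, split along
    its diagonal. *)
Lemma integral_primitive_by_parts g h : int g -> int h ->
  \int[torus]_x (primitive g x * h x) + \int[torus]_x (g x * primitive h x) =
  \int[torus]_x g x * \int[torus]_x h x.
Proof.
move=> gi hi; have := Fubini (integrable_K gi hi).
under eq_integral do rewrite integral_K2//.
under [in RHS]eq_integral do rewrite integral_K1//.
move=> /(congr1 fine) E; rewrite /Rintegral -E -!/(Rintegral _ _ _).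
under eq_Rintegral do rewrite mulrBr.
rewrite RintegralB//; last exact: integrable_mul_primitive.
  by rewrite subrK RintegralZr.
exact: integrable_scaler.
Qed.
End primitives.

(** * Uniqueness of Fourier coefficients *)

Section fourier_uniqueness.
Context {R : realType}.
Implicit Types (a b x : R).

(* This is [cos (pi * (x - x0)) ^ 2]: a trigonometric polynomial with values in
   [[0, 1]] whose superlevel sets are the arcs centred at [x0]. *)
Let arc x0 x : R := (1 + cos (2 * pi * (x - x0))) / 2.

Let arc01 x0 x : 0 <= arc x0 x <= 1.
Proof.
rewrite /arc; have := cos_geN1 (2 * pi * (x - x0)).
by have := cos_le1 (2 * pi * (x - x0)); lra.
Qed.

Let trigpoly_arc x0 : trigpoly (arc x0).
Proof.
rewrite (_ : arc x0 = fun x => 2^-1 + wave 2^-1 1 (- (2 * pi * x0)) x).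
  by apply: trigpolyD; [exact: trigpoly_cst|exact: trigpoly_wave].
by apply/funext => x; rewrite /arc /wave mulr1z mulr1 mulrBr; field.
Qed.

Let cos_lt (r y : R) : 0 <= r -> r < y -> y < 1 - r -> cos (2 * pi * y) < cos (2 * pi * r).
Proof.
move=> r0 ry yr; have pi0 := pi_gt0 R.
have key (z : R) : r < z <= 1 / 2 -> cos (2 * pi * z) < cos (2 * pi * r).
  move=> /andP[rz z2]; rewrite ltr_cos ?in_itv/=.
  - by rewrite ltr_pM2l// mulr_gt0.
  - by apply/andP; split; nra.
  - by apply/andP; split; nra.
have [y2|y2] := leP y (1 / 2); first by apply: key; lra.
rewrite (_ : cos (2 * pi * y) = cos (2 * pi * (1 - y))); first by apply: key; lra.
rewrite -cosN -(cosDint 1); congr cos; rewrite mulr1z; ring.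
Qed.

Let arc_lt x0 r x : 0 <= r -> r < `|x - x0| -> `|x - x0| < 1 - r ->
  arc x0 x < arc x0 (x0 + r).
Proof.
move=> r0 rx xr; rewrite /arc ltr_pM2r ?invr_gt0// ltrD2l addrAC subrr add0r.
have := cos_lt r0 rx xr; congr (_ < _).
by have [_|_] := ler0P (x - x0) => //; rewrite mulrN cosN.
Qed.

Let arc_gt x0 r x : r < 1 / 2 -> `|x - x0| < r -> arc x0 (x0 + r) < arc x0 x.
Proof.
move=> r2 xr; rewrite /arc ltr_pM2r ?invr_gt0// ltrD2l addrAC subrr add0r.
have : cos (2 * pi * r) < cos (2 * pi * `|x - x0|).
  by apply: cos_lt => //; have := normr_ge0 (x - x0); lra.
congr (_ < _).
by have [_|_] := ler0P (x - x0) => //; rewrite mulrN cosN.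
Qed.

Variable v : R -> R.
Hypothesis vi : int v.
Hypothesis v_trig : forall h, trigpoly h -> \int[torus]_x (v x * h x) = 0.

(* The polynomial [y] crosses [1 / 2] exactly at the end points of the arc
   [[a, b]], so that the powers [h n] converge to the indicator of its
   complement, against which [v] is integrated by dominated convergence. *)
Let primitive_short a b : 0 <= a -> a < b -> b <= 1 -> b - a < 1 / 2 ->
  primitive v b = primitive v a.
Proof.
move=> a0 ab b1 ba; have pi0 := pi_gt0 R.
pose x0 := (a + b) / 2; pose r := (b - a) / 2.
pose A := arc x0 (x0 + r).
(* The arc is shorter than a half turn, so that [y] is bounded by 1. *)
have A2 : 1 / 2 < A.
  rewrite /A /arc [_ + r]addrC addrK.
  have : 0 < cos (2 * pi * r) by apply: cos_gt0_pihalf; rewrite /r; nra.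
  by lra.
have A0 : 0 < A by lra.
pose y x := arc x0 x / (2 * A).
have y2 x : 2 * y x = arc x0 x / A by rewrite /y; field; lra.
have y01 x : 0 <= y x <= 1.
  have /andP[c0 c1] := arc01 x0 x; rewrite /y divr_ge0//=; last by lra.
  by rewrite ler_pdivrMr; lra.
pose h n x := (1 - y x ^+ n) ^+ (2 ^ n).
have th n : trigpoly (h n).
  apply: trigpolyX; apply: trigpolyD; first exact: trigpoly_cst.
  rewrite (_ : (fun _ => _) = fun x => -1 * (y x ^+ n)); last by apply/funext => x; rewrite mulN1r.
  apply/trigpolyZ/trigpolyX; rewrite (_ : y = fun x => (2 * A)^-1 * arc x0 x).
    exact: trigpolyZ (trigpoly_arc x0).
  by apply/funext => x; rewrite mulrC.
pose w x := v x * (1 - (\1_(`]-oo, b]) x - \1_(`]-oo, a]) x)).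
have mv := integrable_measurable vi.
have mh n : meas (h n).
  apply: continuous_measurable_fun => x.
  have [_ dh] := trigpoly_derive1 (th n).
  by apply: differentiable_continuous; apply/derivable1_diffP.
have mw : meas w.
  apply: measurable_funM => //; apply: measurable_funB => //.
  by apply: measurable_funB; exact: measurable_indic.
have cvg_hw : {ae torus, forall x, v x * h n x @[n --> \oo] --> w x}.
  apply: filterS3 ae_torus01 (filterI (ae_neq a) (ae_neq b))
    (filterI (ae_neq 0) (ae_neq 1)) => x x01 /= [xa xb] [xn0 xn1].
  have [x0' x1'] : 0 < x /\ x < 1.
    by move: x01; rewrite le_eqVlt eq_sym (negbTE xn0) le_eqVlt (negbTE xn1) => /andP.
  rewrite /w !indic_ray; apply: cvgM; first exact: cvg_cst.
  have [/andP[xa' xb']|xab] := boolP (a < x < b).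
    rewrite (ltW xb') (leNgt x a) xa' /= subr0 subrr.
    apply: cvg_step_gt; first by have /andP[] := y01 x.
    rewrite y2 ltr_pdivlMr// mul1r; apply: arc_gt; first by rewrite /r; lra.
    by rewrite /x0 /r ltr_norml; lra.
  rewrite (_ : 1 - _ = 1); last first.
    move: xab; rewrite negb_and -!leNgt => /orP[xa'|bx].
      by rewrite xa' (le_trans xa' (ltW ab)) subrr subr0.
    have bx' : b < x by rewrite lt_neqAle eq_sym xb.
    by rewrite (leNgt x b) bx' (leNgt x a) (lt_trans ab bx') /= subrr subr0.
  apply: cvg_step_lt; first by have /andP[] := y01 x.
  rewrite y2 ltr_pdivrMr// mul1r; apply: arc_lt.
  - by rewrite /r; lra.
  - move: xab; rewrite negb_and -!leNgt ltr_normr /x0 /r => /orP[xa'|bx]; apply/orP.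
      right; have : x < a by by rewrite lt_neqAle xa.
      by lra.
    left; have : b < x by rewrite lt_neqAle eq_sym xb.
    by lra.
  - by rewrite /x0 /r ltr_norml; lra.
have vT n : int (fun x => v x * h n x).
  apply: (integrable_mul_ae_bounded (K := 1)) => //.
  apply: aeW => x.
  have /andP[y0 y1] := y01 x.
  by rewrite ger0_norm ?exprn_ge0 ?exprn_ile1 ?subr_ge0 ?exprn_ile1// lerBlDr lerDl exprn_ge0.
have h01 n x : 0 <= h n x <= 1.
  have /andP[y0 y1] := y01 x; have Y : 0 <= y x ^+ n <= 1 by rewrite exprn_ge0 ?exprn_ile1.
  by rewrite exprn_ge0 ?exprn_ile1//; lra.
have wi : int w.
  apply: (integrable_ae_dominated mw vi); apply: aeW => x; rewrite /w !indic_ray normrM ler_piMr//.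
  have : ((x <= a) ==> (x <= b))%R by apply/implyP => /le_trans; apply; exact: ltW.
  by case: (x <= a); case: (x <= b) => //= _; rewrite ?subrr ?subr0 ?normr1 ?subrr ?normr0.
have int_w : \int[torus]_x w x = 0.
  have := @dominated_convergence _ _ _ torus setT measurableT
    (fun n => EFin \o (fun x => v x * h n x)) (EFin \o w) (abse \o (EFin \o v)).
  case => [n| | | |//|_ _].
  - exact/measurable_EFinP/integrable_measurable.
  - exact/measurable_EFinP.
  - apply: filterS cvg_hw => x hx _; apply: cvg_EFin; last exact: hx.
    exact: nearW.
  - exact: integrable_abse.
  - apply: aeW => x n _; rewrite /= lee_fin normrM ler_piMr// ger0_norm.
      by have /andP[] := h01 n x.
    by have /andP[] := h01 n x.
  rewrite (_ : (fun n => _) = cst 0%E); last first.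
    apply/funext => n; rewrite /= -[LHS]fineK; last exact: integrable_fin_num (vT n).
    by rewrite [fine _](v_trig (th n)).
  move=> /(cvg_lim (@ereal_hausdorff R)); rewrite lim_cst; last exact: ereal_hausdorff.
  by move=> /(congr1 fine)/= E; rewrite /Rintegral -E.
have vT0 : \int[torus]_x v x = 0.
  rewrite -[RHS](v_trig (trigpoly_cst 1)).
  by apply: eq_Rintegral => x _; rewrite mulr1.
have : \int[torus]_x w x = \int[torus]_x v x - (primitive v b - primitive v a).
  rewrite -RintegralB//; try exact: integrable_ray.
  rewrite -RintegralB//; last exact: integrable_sub (integrable_ray _ _) (integrable_ray _ _).
  by apply: eq_Rintegral => x _; rewrite /w; ring.
by rewrite int_w vT0 => /eqP; rewrite sub0r eq_sym oppr_eq0 subr_eq0 => /eqP.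
Qed.

(** The Fourier coefficients determine an integrable function: [v] is orthogonal
    to the limits of trigonometric polynomials given by [cvg_step_lt] and
    [cvg_step_gt], hence has a constant primitive. *)
Lemma trig_orthogonal_ae0 : {ae torus, forall x, v x = 0}.
Proof.
have prim0 := primitive0 vi.
have prim_lt x : 0 <= x <= 1 -> x < 1 / 2 -> primitive v x = 0.
  rewrite le_eqVlt => /andP[/predU1P[<-//|x0] x1] x2.
  by rewrite (@primitive_short 0 x)// ?subr0.
apply: filterS3 ae_torus01 (ae_neq 1) (primitive_level_ae 0 vi) => x x01 xn1; apply.
(* Two arcs shorter than [1 / 2] reach every [x < 1]. *)
have [x2|x2] := ltP x (1 / 2); first exact: prim_lt.
have x1 : x < 1 by rewrite lt_neqAle xn1; case/andP: x01.
by rewrite (@primitive_short (x / 2) x) ?prim_lt//; lra.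
Qed.
End fourier_uniqueness.

(** * Weak derivatives *)

Section weak_derivatives.
Context {R : realType}.
Local Notation leb := (@lebesgue_measure R).
Implicit Types (u v w z g h phi : R -> R) (x y t c : R).

Lemma ae_bounded_of_continuous g : continuous g ->
  exists K : R, {ae torus, forall x, `|g x| <= K}.
Proof.
move=> cg; have cng : {within `[0, 1], continuous (fun x => `|g x|)}.
  by apply: continuous_subspaceT => x; apply: continuous_comp (@norm_continuous _ R^o _); exact: cg.
have [c _ gc] := EVT_max ler01 cng.
exists `|g c|; apply: filterS ae_torus01 => x x01.
by apply: gc; rewrite in_itv.
Qed.

Lemma continuous_meas g : continuous g -> meas g.
Proof. exact: continuous_measurable_fun. Qed.

Lemma integrable_mul_continuous g h : int g -> continuous h -> int (fun x => g x * h x).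
Proof.
move=> gi ch; have [K hK] := ae_bounded_of_continuous ch.
exact: (integrable_mul_ae_bounded gi (continuous_meas ch) hK).
Qed.

Lemma integrable_continuous g : continuous g -> int g.
Proof.
move=> cg; have [K gK] := ae_bounded_of_continuous cg.
exact: (integrable_ae_bounded (continuous_meas cg) gK).
Qed.

Lemma continuous_test phi : test_function phi -> continuous phi.
Proof.
move=> [_ /(_ 0%N) dphi] x.
by apply: differentiable_continuous; apply/derivable1_diffP; exact: dphi.
Qed.

Lemma continuous_derive1_test phi : test_function phi -> continuous (derive1 phi).
Proof.
move=> [_ /(_ 1%N) dphi] x.
by apply: differentiable_continuous; apply/derivable1_diffP; exact: dphi.
Qed.

Lemma primitive_derive1 phi x : test_function phi -> 0 <= x <= 1 ->
  primitive (derive1 phi) x = phi x - phi 0.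
Proof.
move=> tphi /andP[x0 x1]; have cphi' := continuous_derive1_test tphi.
have iphi' := integrable_continuous cphi'.
move: x0; rewrite le_eqVlt => /predU1P[<-|x0]; first by rewrite primitive0// subrr.
have FTC : (\int[leb]_(t in `[0%R, x]) (derive1 phi t)%:E = (phi x)%:E - (phi 0)%:E)%E.
  apply: continuous_FTC2 => //; first exact: continuous_subspaceT.
  have cphi := continuous_test tphi; split.
  - by move=> t _; have [_ /(_ 0%N t)] := tphi.
  - by apply: cvg_at_right_filter; exact: cphi.
  - by apply: cvg_at_left_filter; exact: cphi.
rewrite primitive_lebesgue// -Rintegral_mkcondr /Rintegral.
rewrite (_ : _ `&` _ = `[0, x]%classic) ?FTC//.
apply/seteqP; split => t /=; rewrite !in_itv/=; first by move=> [-> /andP[->]].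
by move=> /andP[t0 tx]; rewrite tx t0 (le_trans tx).
Qed.

Lemma integral_derive1_test phi : test_function phi -> \int[torus]_x derive1 phi x = 0.
Proof.
move=> tphi; have iphi' := integrable_continuous (continuous_derive1_test tphi).
have -> : \int[torus]_x derive1 phi x = primitive (derive1 phi) 1.
  apply: ae_eq_Rintegral; first exact: integrable_measurable iphi'.
    exact: integrable_measurable (integrable_ray 1 iphi').
  by apply: filterS ae_torus01 => x /andP[_ x1]; rewrite indic_ray x1 mul1r.
have [pphi _] := tphi.
by rewrite primitive_derive1// ?ler01 ?lexx// -[X in phi X]add0r pphi subrr.
Qed.

Lemma inL1P g : inL 1 g <-> int g.
Proof. exact: Lfun1_integrable. Qed.

(** The mean-zero condition makes the primitive periodic. *)
Lemma weak_derivative_primitive g : int g -> \int[torus]_x g x = 0 ->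
  weak_derivative (primitive g) g.
Proof.
move=> gi g0; have mg := measurable_primitive gi.
have pgi : int (primitive g).
  apply: (integrable_ae_bounded mg (K := \int[torus]_x `|g x|)).
  by apply: aeW => x; exact: primitive_le.
split; [exact/inL1P|exact/inL1P|move=> phi tphi].
have iphi' := integrable_continuous (continuous_derive1_test tphi).
have iphi := integrable_mul_continuous gi (continuous_test tphi).
have := integral_primitive_by_parts gi iphi'.
rewrite g0 mul0r => /eqP; rewrite addr_eq0 => /eqP ->; congr (- _).
transitivity (\int[torus]_x (g x * phi x - g x * phi 0)).
  apply: ae_eq_Rintegral; first exact: integrable_measurable (integrable_mul_primitive gi iphi').
    exact: integrable_measurable (integrable_sub iphi (integrable_scaler (phi 0) gi)).
  by apply: filterS ae_torus01 => x x01; rewrite primitive_derive1// mulrBr.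
rewrite RintegralB//; first by rewrite RintegralZr// g0 mul0r subr0.
exact: integrable_scaler.
Qed.

(** The fundamental lemma of the calculus of variations: trigonometric polynomials
    are enough test functions. *)
Lemma test_orthogonal_ae0 g : int g ->
  (forall phi, test_function phi -> \int[torus]_x (g x * phi x) = 0) ->
  {ae torus, forall x, g x = 0}.
Proof.
by move=> gi g0; apply: trig_orthogonal_ae0 => // h /trigpoly_test; exact: g0.
Qed.

(** The lemma of du Bois-Reymond: a trigonometric polynomial is the sum of a
    constant and of the derivative of a test function. *)
Lemma derive_test_orthogonal_ae_cst g : int g ->
  (forall phi, test_function phi -> \int[torus]_x (g x * derive1 phi x) = 0) ->
  {ae torus, forall x, g x = \int[torus]_y g y}.
Proof.
move=> gi g0; set m := \int[torus]_y g y.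
have gmi : int (fun x => g x - m) by exact: integrable_sub gi (integrable_cst _ _).
suff : {ae torus, forall x, g x - m = 0}.
  by apply: filterS => x /eqP; rewrite subr_eq0 => /eqP.
have gm0 : \int[torus]_x (g x - m) = 0.
  rewrite RintegralB//; last exact: integrable_cst.
  by rewrite integral_torus_cst subrr.
apply: trig_orthogonal_ae0 => // h /trigpoly_primitive[phi [c [tphi ->]]].
have cphi' := continuous_derive1_test tphi.
transitivity (\int[torus]_x (g x * derive1 phi x - m * derive1 phi x + c * (g x - m))).
  by apply: eq_Rintegral => x _; ring.
have i1 := integrable_mul_continuous gi cphi'.
have i0 := integrable_continuous cphi'; have i2 := integrable_scale m i0.
rewrite RintegralD//; [|exact: integrable_sub|exact: integrable_scale].
rewrite RintegralB// g0// !RintegralZl//.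
by rewrite [X in m * X](integral_derive1_test tphi) [X in c * X]gm0 !mulr0 subrr addr0.
Qed.

Lemma weak_derivative_integrable u v : weak_derivative u v -> int u /\ int v.
Proof. by move=> [/inL1P ui /inL1P vi _]. Qed.

Lemma weak_derivativeD (a : R) u v w z : weak_derivative u v -> weak_derivative w z ->
  weak_derivative (fun x => a * u x + w x) (fun x => a * v x + z x).
Proof.
move=> uv wz; have [ui vi] := weak_derivative_integrable uv.
have [wi zi] := weak_derivative_integrable wz.
have [_ _ Duv] := uv; have [_ _ Dwz] := wz.
split; try by apply/inL1P/integrable_add => //; exact: integrable_scale.
move=> phi tphi.
have c := continuous_test tphi; have c' := continuous_derive1_test tphi.
have D f1 f2 psi : int f1 -> int f2 -> continuous psi ->
    \int[torus]_x ((a * f1 x + f2 x) * psi x) =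
    a * \int[torus]_x (f1 x * psi x) + \int[torus]_x (f2 x * psi x).
  move=> i1 i2 cpsi; have j1 := integrable_mul_continuous i1 cpsi.
  rewrite -RintegralZl// -RintegralD//; [|exact: integrable_scale|exact: integrable_mul_continuous].
  by apply: eq_Rintegral => x _; ring.
by rewrite !D// Duv// Dwz//; ring.
Qed.

Lemma weak_derivative_cst c : weak_derivative (cst c) (cst 0).
Proof.
have ci a : int (cst a) by exact: integrable_cst.
split; [exact/inL1P|exact/inL1P|move=> phi tphi].
rewrite RintegralZl ?integral_derive1_test ?mulr0//; last first.
  exact: integrable_continuous (continuous_derive1_test tphi).
rewrite [X in - X](_ : _ = 0) ?oppr0//.
by under eq_Rintegral do rewrite mul0r; rewrite integral_torus_cst.
Qed.

Lemma weak_derivative_mean0 u v : weak_derivative u v -> \int[torus]_x v x = 0.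
Proof.
move=> [_ _ /(_ (cst 1))]; have t1 : test_function (cst 1 : R -> R).
  exact/trigpoly_test/trigpoly_cst.
move=> /(_ t1); under eq_Rintegral do rewrite derive1_cst mulr0.
under [in X in _ = X]eq_Rintegral do rewrite mulr1.
by rewrite integral_torus_cst => /eqP; rewrite eq_sym oppr_eq0 => /eqP.
Qed.

Lemma weak_derivative_eq0 u v : weak_derivative u v ->
  {ae torus, forall x, v x = 0} -> {ae torus, forall x, u x = \int[torus]_y u y}.
Proof.
move=> uv v0; have [ui vi] := weak_derivative_integrable uv.
apply: derive_test_orthogonal_ae_cst => // phi tphi; have [_ _ ->//] := uv.
apply/eqP; rewrite oppr_eq0; apply/eqP; transitivity (\int[torus]_x (cst 0 x : R)).
  apply: ae_eq_Rintegral => //.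
    exact: integrable_measurable (integrable_mul_continuous vi (continuous_test tphi)).
  by apply: filterS v0 => x ->; rewrite mul0r.
by rewrite integral_torus_cst.
Qed.

Lemma weak_derivative_unique u v w : weak_derivative u v -> weak_derivative u w ->
  {ae torus, forall x, v x = w x}.
Proof.
move=> uv uw; have := weak_derivativeD (-1) uv uw => -[/inL1P i0 /inL1P vwi D].
suff : {ae torus, forall x, -1 * v x + w x = 0}.
  by apply: filterS => x h; lra.
apply: test_orthogonal_ae0 => // phi tphi.
apply/eqP; rewrite -oppr_eq0 -D//; apply/eqP.
under eq_Rintegral do rewrite mulN1r addNr mul0r.
by rewrite integral_torus_cst.
Qed.

(** The difference of [u] and of the primitive of [v] has weak derivative zero. *)
Lemma weak_derivative_ae_primitive u v : weak_derivative u v ->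
  exists c, {ae torus, forall x, u x = c + primitive v x}.
Proof.
move=> uv; have [_ vi] := weak_derivative_integrable uv.
have pv := weak_derivative_primitive vi (weak_derivative_mean0 uv).
have := weak_derivative_eq0 (weak_derivativeD (-1) pv uv) _.
set c := \int[torus]_y _ => cE; exists c.
have {}cE : {ae torus, forall x, -1 * primitive v x + u x = c}.
  by apply: cE; apply: aeW => x; rewrite mulN1r addNr.
by apply: filterS cE => x <-; ring.
Qed.

Lemma weak_derivative_ae_bounded u v : weak_derivative u v ->
  exists K : R, {ae torus, forall x, `|u x| <= K}.
Proof.
move=> uv; have [_ vi] := weak_derivative_integrable uv.
have [c uc] := weak_derivative_ae_primitive uv.
exists (`|c| + \int[torus]_x `|v x|); apply: filterS uc => x ->.
by rewrite (le_trans (ler_normD _ _))// lerD2l primitive_le.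
Qed.

Lemma integrable_mul_weak u v g : weak_derivative u v -> int g ->
  int (fun x => u x * g x).
Proof.
move=> uv gi; have [ui _] := weak_derivative_integrable uv.
have [K uK] := weak_derivative_ae_bounded uv.
under eq_fun do rewrite mulrC.
exact: (integrable_mul_ae_bounded gi (integrable_measurable ui) uK).
Qed.

(** Both functions are a constant plus a primitive, and the constants integrate
    to zero against functions of mean zero. *)
Lemma weak_by_parts u v w z : weak_derivative u v -> weak_derivative w z ->
  \int[torus]_x (u x * z x) = - \int[torus]_x (v x * w x).
Proof.
move=> uv wz; have [ui vi] := weak_derivative_integrable uv.
have [wi zi] := weak_derivative_integrable wz.
have mul_primitive f c g k : int f -> int g -> weak_derivative f k ->
    \int[torus]_x g x = 0 ->
    {ae torus, forall x, f x = c + primitive k x} ->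
    \int[torus]_x (f x * g x) = \int[torus]_x (primitive k x * g x).
  move=> fi gi fk g0 fc; have [_ ki] := weak_derivative_integrable fk.
  have kgi : int (fun x => primitive k x * g x).
    by under eq_fun do rewrite mulrC; exact: integrable_mul_primitive.
  transitivity (\int[torus]_x (c * g x + primitive k x * g x)).
    apply: ae_eq_Rintegral.
    - exact: integrable_measurable (integrable_mul_weak fk gi).
    - exact: integrable_measurable (integrable_add (integrable_scale c gi) kgi).
    - by apply: filterS fc => x ->; rewrite mulrDl.
  rewrite RintegralD//; last exact: integrable_scale.
  by rewrite RintegralZl// g0 mulr0 add0r.
have [c uc] := weak_derivative_ae_primitive uv.
have [e we] := weak_derivative_ae_primitive wz.
have v0 := weak_derivative_mean0 uv; have z0 := weak_derivative_mean0 wz.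
rewrite (mul_primitive _ _ _ _ ui zi uv z0 uc).
under [in RHS]eq_Rintegral do rewrite mulrC.
rewrite (mul_primitive _ _ _ _ wi vi wz v0 we).
under [in RHS]eq_Rintegral do rewrite mulrC.
apply/eqP; rewrite -addr_eq0; apply/eqP.
by rewrite integral_primitive_by_parts// z0 mulr0.
Qed.

Lemma grad_weak u v : weak_derivative u v -> weak_derivative u (grad u).
Proof. by move=> uv; apply: (@xgetPex _ (cst 0) [set v | weak_derivative u v]); exists v. Qed.

Lemma grad_ae u v : weak_derivative u v -> {ae torus, forall x, grad u x = v x}.
Proof. by move=> uv; exact: weak_derivative_unique (grad_weak uv) uv. Qed.
End weak_derivatives.

(** * Lebesgue and Sobolev spaces *)

Section lebesgue_spaces.
Context {R : realType}.
Implicit Types (u v f g : R -> R) (p q : R).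

Lemma inLP p f : inL p f <-> meas f /\ (normL p f < +oo)%E.
Proof.
rewrite /inL inE; split.
  by move=> /andP[/[!inE]/= mf nf].
by move=> [mf nf]; apply/andP; rewrite !inE.
Qed.

Lemma inL_integrable p f : 1 <= p -> inL p f -> int f.
Proof.
move=> p1 fp; apply/Lfun1_integrable; apply: (@Lfun_subset _ _ _ torus 1%E p%:E) => //.
by rewrite [X in X \is a fin_num]torus_setT.
Qed.

Lemma inL_powR_integrable p f : 1 <= p -> inL p f -> int (fun x => `|f x| `^ p).
Proof. by move=> p1 fp; exact: Lfun_integrable p1 fp. Qed.

Lemma normL_ae_eq p f g : meas f -> meas g ->
  {ae torus, forall x, f x = g x} -> normL p f = normL p g.
Proof.
move=> mf mg fg; rewrite /normL unlock /=; congr (_ `^ _)%E.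
apply: ae_eq_integral => //.
- apply/measurable_EFinP; apply: (@measurableT_comp _ _ _ _ _ _ (@powR R ^~ p)) => //.
  exact: measurableT_comp.
- apply/measurable_EFinP; apply: (@measurableT_comp _ _ _ _ _ _ (@powR R ^~ p)) => //.
  exact: measurableT_comp.
- by apply: filterS fg => x /= -> _.
Qed.

Lemma inL_ae_eq p f g : meas g -> {ae torus, forall x, f x = g x} -> inL p f -> inL p g.
Proof.
move=> mg fg /inLP[mf nf]; apply/inLP; split => //.
by rewrite -(normL_ae_eq p mf mg fg).
Qed.

Lemma hoelder_integrable p q f g : 0 < p -> 0 < q -> p^-1 + q^-1 = 1 ->
  inL p f -> inL q g ->
  int (fun x => f x * g x) /\
  (`|\int[torus]_x (f x * g x)|%:E <= normL p f * normL q g)%E.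
Proof.
move=> p0 q0 pq /inLP[mf nf] /inLP[mg ng].
have := hoelder torus mf mg p0 q0 pq; rewrite Lnorm1 => h.
have fgi : int (fun x => f x * g x).
  apply/integrableP; split; first exact/measurable_EFinP/measurable_funM.
  apply: (le_lt_trans h); rewrite lte_mul_pinfty ?Lnorm_ge0// ge0_fin_numE ?Lnorm_ge0//.
split=> //; apply: le_trans h.
rewrite EFin_normr_Rintegral//; apply: le_abse_integral => //.
exact: measurable_int fgi.
Qed.

Lemma inLD (a : R) p u v : 1 <= p -> inL p u -> inL p v ->
  inL p (fun x => a * u x + v x).
Proof.
move=> p1 up vp.
have p1' : (1 <= p%:E)%E by [].
rewrite /inL (_ : (fun _ => _) = (a \o* u) + v).
  exact: (Lfun_addr_closed torus p1').2 _ _ (Lfun_scale a p1 up) vp.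
by apply/funext => x; rewrite /= mulrC.
Qed.

Lemma inL_cst p (a : R) : inL p (cst a).
Proof. exact: Lfun_cst. Qed.

Lemma inL_ae_bounded p f (K : R) : 0 < p -> meas f ->
  {ae torus, forall x, `|f x| <= K} -> inL p f.
Proof.
move=> p0 mf fK; apply/inLP; split=> //.
rewrite /normL unlock /= poweR_lty//.
suff pf : int (fun x => `|f x| `^ p) by exact: integrable_lty pf.
apply: (integrable_ae_bounded (K := `|K| `^ p)).
  by apply: (@measurableT_comp _ _ _ _ _ _ (@powR R ^~ p)) => //; exact: measurableT_comp.
apply: filterS fK => x fK; rewrite ger0_norm ?powR_ge0// ge0_ler_powR ?nnegrE//; first exact: ltW.
exact: le_trans fK (ler_norm _).
Qed.
End lebesgue_spaces.

Section sobolev.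
Context {R : realType}.
Implicit Types (u v w z : R -> R) (s p q : R).

Lemma weak_derivative_ae u v u' v' : weak_derivative u v -> meas u' -> meas v' ->
  {ae torus, forall x, u x = u' x} -> {ae torus, forall x, v x = v' x} ->
  weak_derivative u' v'.
Proof.
move=> uv mu' mv' uu' vv'; have [ui vi] := weak_derivative_integrable uv.
have ui' := integrable_ae_eq mu' ui uu'; have vi' := integrable_ae_eq mv' vi vv'.
split; [exact/inL1P|exact/inL1P|move=> phi tphi].
have E (g g' psi : R -> R) : int g -> int g' ->
    {ae torus, forall x, g x = g' x} -> continuous psi ->
    \int[torus]_x (g' x * psi x) = \int[torus]_x (g x * psi x).
  move=> gi gi' gg' cpsi; apply: ae_eq_Rintegral.
  - exact: integrable_measurable (integrable_mul_continuous gi' cpsi).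
  - exact: integrable_measurable (integrable_mul_continuous gi cpsi).
  - by apply: filterS gg' => x ->.
rewrite (E _ _ _ ui ui' uu' (continuous_derive1_test tphi)).
rewrite (E _ _ _ vi vi' vv' (continuous_test tphi)).
by have [_ _ ->] := uv.
Qed.

Lemma inWP s u : inW s u <->
  [/\ inL s u, inL s (grad u) & weak_derivative u (grad u)].
Proof.
split=> [[us [v vs uv]]|[us gs ug]]; last by split=> //; exists (grad u).
have ug := grad_weak uv; split => //.
have [_ gi] := weak_derivative_integrable ug.
apply: inL_ae_eq vs; first exact: integrable_measurable gi.
by apply: filterS (grad_ae uv) => x ->.
Qed.

Lemma inWD (a : R) s u v : 1 <= s -> inW s u -> inW s v ->
  inW s (fun x => a * u x + v x).
Proof.
move=> s1 /inWP[us gus ug] /inWP[vs gvs vg]; split; first exact: inLD.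
exists (fun x => a * grad u x + grad v x); first exact: inLD.
exact: weak_derivativeD.
Qed.

Lemma inW_cst s (a : R) : inW s (cst a).
Proof.
split; first exact: inL_cst.
by exists (cst 0); [exact: inL_cst|exact: weak_derivative_cst].
Qed.

Lemma inW_centered s u : 1 <= s -> inW s u -> inW s (centered u).
Proof.
move=> s1 us; rewrite (_ : centered u = fun x => 1 * u x + cst (- \int[torus]_y u y) x).
  by apply: inWD => //; exact: inW_cst.
by apply/funext => x; rewrite /centered mul1r.
Qed.

Lemma normL_ae0 p u : 0 < p -> meas u -> {ae torus, forall x, u x = 0} -> normL p u = 0%E.
Proof.
move=> p0 mu u0; rewrite (@normL_ae_eq _ p u (cst 0))//.
by rewrite /normL Lnorm0//= gt_eqF.
Qed.

(** The difference of [u] and [v] has norm zero. *)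
Lemma bounded_functional_ae_eq s L u v : 1 <= s ->
  bounded_functional (inW s) (normW s) L -> inW s u -> inW s v ->
  {ae torus, forall x, u x = v x} -> L u = L v.
Proof.
move=> s1 [Llin [K LK]] us vs uv; have s0 : 0 < s by exact: lt_le_trans s1.
have ws := inWD (-1) s1 us vs; move: (Llin (-1) u v us vs) (LK _ ws).
set w := (fun x => -1 * u x + v x) in ws * => ->.
have /inWP[wL gL wg] := ws.
have w0 : {ae torus, forall x, w x = 0}.
  by apply: filterS uv => x ux; rewrite /w ux mulN1r addNr.
have [wi gi] := weak_derivative_integrable wg.
have mw := integrable_measurable wi; have mg := integrable_measurable gi.
have g0 : {ae torus, forall x, grad w x = 0}.
  apply: (weak_derivative_unique wg).
  apply: (weak_derivative_ae (weak_derivative_cst 0)) => //.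
  - by apply: filterS w0 => x ->.
  - exact: aeW.
rewrite /normW !normL_ae0// adde0 mule0 lee_fin normr_le0 mulN1r.
by rewrite addrC subr_eq0 => /eqP.
Qed.

(** The embedding followed by Hoelder's inequality. *)
Lemma bounded_functional_pairing s q q' g : 1 <= s -> 0 < q -> 0 < q' ->
  q^-1 + q'^-1 = 1 -> sobolev_embedding s q' -> inL q g ->
  bounded_functional (inW s) (normW s) (fun u => \int[torus]_x (u x * g x)).
Proof.
move=> s1 q0 q'0 qq' [emb [K embK]] gq.
have qq'' : q'^-1 + q^-1 = 1 by rewrite addrC.
split=> [a u v /emb us /emb vs|].
  have [ui _] := hoelder_integrable q'0 q0 qq'' us gq.
  have [vi _] := hoelder_integrable q'0 q0 qq'' vs gq.
  rewrite -RintegralZl// -RintegralD//; last exact: integrable_scale.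
  by apply: eq_Rintegral => x _; ring.
have [mg ng] := (inLP _ _).1 gq.
exists (K * fine (normL q g)) => u us.
have [_] := hoelder_integrable q'0 q0 qq'' (emb _ us) gq.
move=> /le_trans; apply; rewrite EFinM fineK ?ge0_fin_numE ?Lnorm_ge0//.
rewrite -muleA [(normL q g * _)%E]muleC muleA lee_wpmul2r ?Lnorm_ge0//.
exact: embK.
Qed.

Lemma bounded_functional_pairingL q q' g : 0 < q -> 0 < q' ->
  q^-1 + q'^-1 = 1 -> inL q' g ->
  bounded_functional (inL q) (normL q) (fun u => \int[torus]_x (u x * g x)).
Proof.
move=> q0 q'0 qq' gq; split=> [a u v us vs|].
  have [ui _] := hoelder_integrable q0 q'0 qq' us gq.
  have [vi _] := hoelder_integrable q0 q'0 qq' vs gq.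
  rewrite -RintegralZl// -RintegralD//; last exact: integrable_scale.
  by apply: eq_Rintegral => x _; ring.
have [mg ng] := (inLP _ _).1 gq.
exists (fine (normL q' g)) => u us.
have [_] := hoelder_integrable q0 q'0 qq' us gq.
by rewrite fineK ?ge0_fin_numE ?Lnorm_ge0// muleC.
Qed.

Lemma selection_functionalE m u : int u -> int (fun x => u x * m x) -> int m ->
  \int[torus]_x m x = 1 ->
  selection_functional m u = \int[torus]_x (u x * m x) - \int[torus]_x u x.
Proof.
move=> ui umi mi m1; rewrite /selection_functional /centered.
transitivity (\int[torus]_x (u x * m x - \int[torus]_y u y * m x)).
  by apply: eq_Rintegral => x _; rewrite mulrBl.
by rewrite RintegralB ?RintegralZl ?m1 ?mulr1//; exact: integrable_scale.
Qed.
End sobolev.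

(** * The Hamiltonian and the coupling *)

Lemma measurable_superposition (R : realType) (F : R * R -> R) (g : R -> R) : continuous F ->
  measurable_fun (setT : set (measurableTypeR R)) g ->
  measurable_fun (setT : set (measurableTypeR R)) (fun x => F (x, g x)).
Proof.
move=> cF mg; apply: (measurable_caratheodory (F := fun x r => F (x, r))) => // [r|x].
  apply: continuous_measurable_fun => x.
  apply: (@continuous_comp _ _ _ (fun x : R => (x, r)) F); last exact: cF.
  exact: (cvg_pair cvg_id (cvg_cst r)).
move=> r; apply: (@continuous_comp _ _ _ (fun r : R => (x : R, r)) F); last exact: cF.
exact: (cvg_pair (cvg_cst (x : R)) cvg_id).
Qed.

Lemma measurable_le_set (R : realType) (g h : R -> R) :
  measurable_fun (setT : set (measurableTypeR R)) g ->
  measurable_fun (setT : set (measurableTypeR R)) h ->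
  measurable ([set x | g x <= h x] : set (measurableTypeR R)).
Proof.
move=> mg mh.
rewrite (_ : [set x | _] = setT `&` (fun x => g x <= h x) @^-1` [set true]).
  exact: measurable_fun_ler mg mh _ _ _.
by apply/seteqP; split => x //= [].
Qed.

Section hamiltonian_regularity.
Context {R : realType}.
Variable H : R -> R -> R.
Hypothesis H_C1 : class_C1 (fun z : R * R => H z.1 z.2).

Let F : R * R -> R := fun z => H z.1 z.2.

Let line (x p : R) : (fun h : R => h^-1 *: ((H x \o shift p) (h *: 1) - H x p)) =
  (fun h : R => h^-1 *: ((F \o shift (x, p)) (h *: (0, 1)) - F (x, p))).
Proof.
apply/funext => h; rewrite /= /F /=; congr (_ *: (H _ _ - _)).
by rewrite scaler0 add0r.
Qed.

Lemma derivable_hamiltonian x p : derivable (H x) p 1.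
Proof.
have [dF _] := H_C1; have : derivable F (x, p) (0, 1) by apply: diff_derivable; exact: dF.
by rewrite /derivable line.
Qed.

Lemma Dp_diff x p : Dp H x p = 'd F (x, p) (0, 1).
Proof.
have [dF _] := H_C1; rewrite /Dp derive1E -deriveE; last exact: dF.
by rewrite /derive line.
Qed.

Lemma continuous_hamiltonian : continuous F.
Proof. by move=> z; apply: differentiable_continuous; exact: (H_C1.1 z). Qed.

Lemma continuous_Dp : continuous (fun z : R * R => Dp H z.1 z.2).
Proof.
rewrite (_ : (fun _ => _) = fun z => 'd F z (0, 1)); first exact: H_C1.2.
by apply/funext => -[x p]; rewrite Dp_diff.
Qed.

End hamiltonian_regularity.

Section coupling.
Context {R : realType}.
Variables (q : R) (f : R -> R -> R).
Hypothesis q_gt1 : 1 < q.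
Hypothesis f_continuous : {within [set z : R * R | 0 <= z.2],
  continuous (fun z : R * R => f z.1 z.2)}.
Hypothesis f_increasing : forall x r1 r2, 0 <= r1 -> r1 < r2 -> f x r1 < f x r2.
Hypothesis f_growth : exists2 C : R, 0 < C &
  forall x r, 0 <= r -> `|f x r| <= C * (1 + r `^ (q - 1)).
Implicit Types (m : R -> R) (x : R).

(** The function [f] is only continuous at nonnegative densities; composing it
    with the positive part gives a function of [x] that is Borel even where
    [m < 0]. *)
Definition coupling m x : R := f x (Num.max 0 (m x)).

Lemma coupling_pos m x : 0 <= m x -> coupling m x = f x (m x).
Proof. by move=> m0; rewrite /coupling max_r. Qed.

Let continuous_fplus : continuous (fun z : R * R => f z.1 (Num.max 0 z.2)).
Proof.
pose A := [set z : R * R | 0 <= z.2].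
pose g (z : R * R) := (z.1, Num.max 0 z.2).
have Ag z : A (g z) by rewrite /A /= le_max lexx.
have cg : continuous g.
  move=> [x r]; have c1 : z.1 @[z --> (x, r)] --> x by exact: cvg_fst.
  have c2 : {for (x, r), continuous (fun z : R * R => z.2)} by exact: cvg_snd.
  have c0 : {for (x, r), continuous (fun z : R * R => 0 : R)} by exact: cvg_cst.
  exact: (cvg_pair c1 (continuous_max c0 c2)).
move=> z; apply: (@cvg_comp _ _ _ g (fun z : R * R => f z.1 z.2) _ (within A (nbhs (g z)))).
  move=> P wP; have := cg z _ wP; rewrite /nbhs /=; apply: filterS => y Py.
  exact: Py (Ag y).
by have /subspace_continuousP := f_continuous; apply; exact: Ag.
Qed.

Lemma measurable_coupling m : meas m -> meas (coupling m).
Proof. exact: (measurable_superposition continuous_fplus). Qed.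

(** By the growth of [f] and the elementary inequality
    [a * b ^ (q - 1) <= a ^ q + b ^ q]. *)
Lemma integrable_mul_coupling m1 m2 : inL q m1 -> inL q m2 ->
  int (fun x => m1 x * coupling m2 x).
Proof.
move=> m1q m2q; have q0 : 0 < q by exact: lt_trans q_gt1.
have [mm1 _] := (inLP _ _).1 m1q; have [mm2 _] := (inLP _ _).1 m2q.
have [C C0 fC] := f_growth.
have i1 := inL_integrable (ltW q_gt1) m1q.
have i2 := inL_powR_integrable (ltW q_gt1) m1q.
have i3 := inL_powR_integrable (ltW q_gt1) m2q.
have i4 := integrable_scale C (integrable_add (integrable_norm i1) (integrable_add i2 i3)).
apply: (integrable_ae_dominated _ i4).
  by apply: measurable_funM => //; exact: measurable_coupling.
apply: aeW => x; rewrite [leRHS]ger0_norm; last first.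
  apply: mulr_ge0; first exact: ltW.
  by apply: addr_ge0; [exact: normr_ge0|apply: addr_ge0; exact: powR_ge0].
rewrite normrM; set r := Num.max 0 (m2 x).
have r0 : 0 <= r by rewrite /r le_max lexx.
have rm2 : r <= `|m2 x| by rewrite /r ge_max normr_ge0 ler_norm.
apply: (@le_trans _ _ (`|m1 x| * (C * (1 + r `^ (q - 1))))).
  by rewrite ler_wpM2l//; exact: fC.
rewrite mulrCA; apply: ler_wpM2l; first exact: ltW.
rewrite mulrDr mulr1 lerD2l /=.
have q1 : 0 <= q - 1 by rewrite subr_ge0 ltW.
have powE (b : R) : 0 <= b -> b `^ q = b * b `^ (q - 1).
  by move=> b0; rewrite mulr_powRB1.
have [rm1|m1r] := leP r `|m1 x|.
  apply: (@le_trans _ _ (`|m1 x| `^ q)); last by rewrite lerDl powR_ge0.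
  by rewrite powE// ler_wpM2l// ge0_ler_powR// nnegrE.
apply: (@le_trans _ _ (`|m2 x| `^ q)); last by rewrite lerDr powR_ge0.
apply: (@le_trans _ _ (r `^ q)); last by rewrite ge0_ler_powR ?nnegrE// ltW.
by rewrite powE// ler_wpM2r ?powR_ge0// ltW.
Qed.

Lemma coupling_monotone x (r1 r2 : R) : 0 <= r1 -> 0 <= r2 ->
  0 <= (r1 - r2) * (f x r1 - f x r2) ?= iff (r1 == r2).
Proof.
move=> r10 r20; case: (ltgtP r1 r2) => [r12|r21|->]; last first.
- by rewrite subrr mul0r; split=> //; rewrite !eqxx.
- have := f_increasing x r20 r21; split; first by nra.
  by rewrite lt_eqF//; nra.
- have := f_increasing x r10 r12; split; first by nra.
  by rewrite lt_eqF//; nra.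
Qed.

(** The sum [S] is minus the integral of [m1 - m2] times the increment of the
    coupling, which has the sign of [m1 - m2]. *)
Lemma coupling_exchange m1 m2 : inL q m1 -> inL q m2 ->
  {ae torus, forall x, 0 <= m1 x} -> {ae torus, forall x, 0 <= m2 x} ->
  let S := \int[torus]_x (m1 x * coupling m2 x - m1 x * coupling m1 x) +
           \int[torus]_x (m2 x * coupling m1 x - m2 x * coupling m2 x) in
  S <= 0 /\ (0 <= S -> {ae torus, forall x, m1 x = m2 x}).
Proof.
move=> m1q m2q m10 m20 S.
have i11 := integrable_mul_coupling m1q m1q; have i12 := integrable_mul_coupling m1q m2q.
have i21 := integrable_mul_coupling m2q m1q; have i22 := integrable_mul_coupling m2q m2q.
pose D x := (m1 x - m2 x) * (coupling m1 x - coupling m2 x).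
have DE x : D x = (m1 x * coupling m1 x - m1 x * coupling m2 x) +
                  (m2 x * coupling m2 x - m2 x * coupling m1 x) by rewrite /D; ring.
have Di : int D.
  rewrite (funext DE : D = _).
  exact: (integrable_add (integrable_sub i11 i12) (integrable_sub i22 i21)).
have D0 : {ae torus, forall x, 0 <= D x ?= iff (m1 x == m2 x)}.
  apply: filterS2 m10 m20 => x m1x m2x; rewrite /D !coupling_pos//.
  exact: coupling_monotone.
have SE : S = - \int[torus]_x D x.
  under eq_Rintegral do rewrite DE.
  rewrite RintegralD//; try exact: integrable_sub.
  by rewrite /S !RintegralB//; ring.
have intD0 : 0 <= \int[torus]_x D x.
  rewrite -(integral_torus_cst 0); apply: ae_le_Rintegral => //; first exact: integrable_cst.
  by apply: filterS D0 => x [].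
split=> [|S0]; first by rewrite SE oppr_le0.
have aeD : {ae torus, forall x, D x = 0}.
  apply: Rintegral_le0_ae_eq0 => //; first by apply: filterS D0 => x [].
  by rewrite SE oppr_ge0 in S0.
by apply: filterS2 D0 aeD => x [_ e] Dx; apply/eqP; rewrite -e Dx.
Qed.

End coupling.

(** * Mean field systems *)

Section mean_field_games.
Context {R : realType}.
Variables (s s' q q' : R) (H f : R -> R -> R).
Hypothesis s_gt1 : 1 < s.
Hypothesis q_gt1 : 1 < q.
Hypothesis conj_s : s^-1 + s'^-1 = 1.
Hypothesis conj_q : q^-1 + q'^-1 = 1.
Hypothesis embedding : sobolev_embedding s q'.
Hypothesis H_C1 : class_C1 (fun z : R * R => H z.1 z.2).
Hypothesis H_convex : forall x, strictly_convex (H x).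
Hypothesis f_continuous : {within [set z : R * R | 0 <= z.2],
  continuous (fun z : R * R => f z.1 z.2)}.
Hypothesis f_increasing : forall x r1 r2, 0 <= r1 -> r1 < r2 -> f x r1 < f x r2.
Hypothesis f_growth : exists2 C : R, 0 < C &
  forall x r, 0 <= r -> `|f x r| <= C * (1 + r `^ (q - 1)).
Implicit Types (u v m p : R -> R) (eps lambda x : R).

Let q0 : 0 < q. Proof. exact: lt_trans q_gt1. Qed.
Let q'_gt1 : 1 < q'. Proof. exact: conjugate_gt1 q_gt1 conj_q. Qed.
Let q'0 : 0 < q'. Proof. exact: lt_trans q'_gt1. Qed.
Let s'_gt1 : 1 < s'. Proof. exact: conjugate_gt1 s_gt1 conj_s. Qed.

(** The common form of the two problems, ergodic for [eps = 0] and discounted for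
    [lambda = 0]. The transport equation says that the flux has a weak
    derivative, which makes it available to [weak_by_parts]. *)
Record mfg_system eps lambda u m p : Prop := MfgSystem {
  mfg_value : inL q' u;
  mfg_gradient : weak_derivative u p;
  mfg_density : inL q m;
  mfg_density_ge0 : {ae torus, forall x, 0 <= m x};
  mfg_mass : \int[torus]_x m x = 1;
  mfg_hj_le : {ae torus, forall x,
    eps * u x + H x (p x) <= coupling f m x + lambda};
  mfg_hj_eq : {ae torus, forall x,
    0 < m x -> eps * u x + H x (p x) = coupling f m x + lambda};
  mfg_transport : weak_derivative (fun x => m x * Dp H x (p x))
    (fun x => eps * (m x - 1)) }.

Lemma ergodic_mfg u m lambda : ergodic_solution s s' q H f u m lambda ->
  mfg_system 0 lambda u m (grad u).
Proof.
move=> [us mq [m0 m1 fs'] [le eq] tr]; have /inWP[_ _ ug] := us.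
have mi := inL_integrable (ltW q_gt1) mq.
split=> //.
- exact: embedding.1.
- by apply: filterS2 m0 le => x mx; rewrite mul0r add0r coupling_pos.
- by apply: filterS2 m0 eq => x mx; rewrite mul0r add0r coupling_pos.
split=> [||phi tphi].
- exact/inL1P/(inL_integrable (ltW s'_gt1)).
- by apply/inL1P/integrable_scale/integrable_sub => //; exact: integrable_cst.
rewrite [LHS]tr//; under eq_Rintegral do rewrite mul0r mul0r.
by rewrite integral_torus_cst oppr0.
Qed.

Lemma discounted_mfg eps u m : discounted_solution s s' q H f eps u m ->
  mfg_system eps 0 u m (grad u).
Proof.
move=> [us mq [m0 m1 fs'] [le eq] tr]; have /inWP[_ _ ug] := us.
have mi := inL_integrable (ltW q_gt1) mq.
split=> //.
- exact: embedding.1.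
- by apply: filterS2 m0 le => x mx; rewrite addr0 coupling_pos.
- by apply: filterS2 m0 eq => x mx; rewrite addr0 coupling_pos.
split=> [||phi tphi].
- exact/inL1P/(inL_integrable (ltW s'_gt1)).
- by apply/inL1P/integrable_scale/integrable_sub => //; exact: integrable_cst.
have cphi := continuous_test tphi.
have i1 := integrable_scale eps (integrable_mul_continuous mi cphi).
have i2 := integrable_scale eps (integrable_continuous cphi).
have /eqP := tr _ tphi; rewrite addrC eq_sym -subr_eq => /eqP <-.
rewrite -[LHS]opprB; congr (- _).
transitivity (\int[torus]_x (eps * (m x * phi x) - eps * phi x)); last first.
  by apply: eq_Rintegral => x _; ring.
rewrite RintegralB//; congr (_ - _).
by apply: eq_Rintegral => x _; rewrite mulrA.
Qed.

(** Duality between two solutions, possibly of different problems: the tangent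
    inequality of [H x] at [p1 x], weighted by [m1], is integrated; its linear
    term is computed by testing the transport equation of the first solution
    with [u2 - u1]. *)
Lemma mfg_duality e1 e2 l1 l2 u1 u2 m1 m2 p1 p2 :
  mfg_system e1 l1 u1 m1 p1 -> mfg_system e2 l2 u2 m2 p2 ->
  let gap := \int[torus]_x (m1 x * coupling f m2 x - m1 x * coupling f m1 x) +
    (l2 - l1) - e2 * \int[torus]_x (u2 x * m1 x) +
    e1 * (\int[torus]_x (u2 x * m1 x) - \int[torus]_x u2 x + \int[torus]_x u1 x) in
  0 <= gap /\ (gap <= 0 -> {ae torus, forall x, 0 < m1 x -> p1 x = p2 x}).
Proof.
move=> [u1q w1 m1q m10 m11 _ eq1 tr1] [u2q w2 m2q m20 m21 le2 _ _] gap.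
have qq : q'^-1 + q^-1 = 1 by rewrite addrC.
have im1 := inL_integrable (ltW q_gt1) m1q.
have [iu1 ip1] := weak_derivative_integrable w1.
have [iu2 ip2] := weak_derivative_integrable w2.
have [iu1m _] := hoelder_integrable q'0 q0 qq u1q m1q.
have [iu2m _] := hoelder_integrable q'0 q0 qq u2q m1q.
have i12 := integrable_mul_coupling q_gt1 f_continuous f_growth m1q m2q.
have i11 := integrable_mul_coupling q_gt1 f_continuous f_growth m1q m1q.
have w12 := weak_derivativeD (-1) w1 w2.
set flux1 := (fun x => m1 x * Dp H x (p1 x)) in tr1.
have [_ ip12] := weak_derivative_integrable w12.
have iflux := integrable_mul_weak tr1 ip12.
have fluxE := weak_by_parts tr1 w12.
pose A x := m1 x * coupling f m2 x - m1 x * coupling f m1 x.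
pose B x := (l2 - l1) * m1 x - e2 * (u2 x * m1 x).
pose C x := e1 * (u1 x * m1 x) - flux1 x * (-1 * p1 x + p2 x).
(* [E] is [m1] times the right-hand side minus the left-hand side of the tangent
   inequality, with [H] replaced through the Hamilton-Jacobi relations. *)
pose E x := A x + (B x + C x).
have iA : int A by exact: integrable_sub.
have iB : int B by exact: (integrable_sub (integrable_scale _ im1) (integrable_scale _ iu2m)).
have iC : int C by exact: (integrable_sub (integrable_scale _ iu1m) iflux).
have iBC := integrable_add iB iC.
have iE : int E by exact: integrable_add.
have intE : \int[torus]_x E x = gap.
  have -> : \int[torus]_x E x = \int[torus]_x A x + (\int[torus]_x B x + \int[torus]_x C x).
    by rewrite -(RintegralD measurableT iB iC) -(RintegralD measurableT iA iBC).
  have -> : \int[torus]_x B x =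
      (l2 - l1) * \int[torus]_x m1 x - e2 * \int[torus]_x (u2 x * m1 x).
    by rewrite /B RintegralB ?RintegralZl//; exact: integrable_scale.
  have -> : \int[torus]_x C x =
      e1 * \int[torus]_x (u1 x * m1 x) - \int[torus]_x (flux1 x * (-1 * p1 x + p2 x)).
    by rewrite /C RintegralB ?RintegralZl//; exact: integrable_scale.
  rewrite fluxE m11.
  have -> : \int[torus]_x (e1 * (m1 x - 1) * (-1 * u1 x + u2 x)) =
     e1 * ((\int[torus]_x (u2 x * m1 x) - \int[torus]_x (u1 x * m1 x)) -
     (\int[torus]_x u2 x - \int[torus]_x u1 x)).
    rewrite -!RintegralB//; try exact: integrable_sub.
    rewrite -RintegralZl//; last by apply: integrable_sub; exact: integrable_sub.
    by apply: eq_Rintegral => x _; ring.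
  by rewrite /gap -/(A _); ring.
have E0 : {ae torus, forall x, 0 <= E x /\ (E x <= 0 -> 0 < m1 x -> p1 x = p2 x)}.
  apply: filterS3 m10 eq1 le2 => x m1x eq1x le2x.
  have EE : E x = m1 x * ((coupling f m2 x + l2 - e2 * u2 x) -
      (coupling f m1 x + l1 - e1 * u1 x) - Dp H x (p1 x) * (p2 x - p1 x)).
    by rewrite /E /A /B /C /flux1; ring.
  move: m1x; rewrite le_eqVlt => /predU1P[m1x|m1x].
    by rewrite EE -m1x mul0r ltxx.
  have dH := @derivable_hamiltonian R H H_C1 x (p1 x).
  have eqx := eq1x m1x.
  have tg := tangent_le (p2 x) (H_convex x) dH; rewrite -/(Dp H x (p1 x)) in tg.
  split=> [|Ex _]; first by rewrite EE mulr_ge0 ?(ltW m1x)//; lra.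
  apply/eqP/negPn/negP => p12.
  have := tangent_lt (H_convex x) dH p12; rewrite -/(Dp H x (p1 x)) => tl.
  by move: Ex; rewrite EE pmulr_rle0//; lra.
split=> [|gap0].
  rewrite -intE -(integral_torus_cst 0); apply: ae_le_Rintegral => //.
    exact: integrable_cst.
  by apply: filterS E0 => x [].
have Ez : {ae torus, forall x, E x = 0}.
  apply: Rintegral_le0_ae_eq0 => //; first by apply: filterS E0 => x [].
  by rewrite intE.
by apply: filterS2 E0 Ez => x [_ e] Ex; apply: e; rewrite Ex.
Qed.

(** Lasry-Lions monotonicity: the gaps of [mfg_duality] for the two orderings of
    the solutions are nonnegative and add up to a nonpositive number. *)
Lemma ergodic_unique u1 u2 m1 m2 l1 l2 :
  ergodic_solution s s' q H f u1 m1 l1 -> ergodic_solution s s' q H f u2 m2 l2 ->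
  [/\ {ae torus, forall x, m1 x = m2 x}, l1 = l2 &
      {ae torus, forall x, 0 < m1 x -> grad u1 x = grad u2 x}].
Proof.
move=> /ergodic_mfg S1 /ergodic_mfg S2.
have [le12 _] := mfg_duality S1 S2; have [le21 _] := mfg_duality S2 S1.
have [_ m12] := coupling_exchange q_gt1 f_continuous f_increasing f_growth
  (mfg_density S1) (mfg_density S2) (mfg_density_ge0 S1) (mfg_density_ge0 S2).
have {}m12 : {ae torus, forall x, m1 x = m2 x} by apply: m12; lra.
have I0 m m' : inL q m -> inL q m' -> {ae torus, forall x, m x = m' x} ->
    \int[torus]_x (m x * coupling f m' x - m x * coupling f m x) = 0.
  move=> mq mq' mm'; rewrite -[RHS](integral_torus_cst 0).
  have i := integrable_mul_coupling q_gt1 f_continuous f_growth.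
  apply: ae_eq_Rintegral => //.
    exact: integrable_measurable (integrable_sub (i _ _ mq mq') (i _ _ mq mq)).
  by apply: filterS mm' => x mx; rewrite /coupling mx subrr.
have I12 := I0 _ _ (mfg_density S1) (mfg_density S2) m12.
have I21 : \int[torus]_x (m2 x * coupling f m1 x - m2 x * coupling f m2 x) = 0.
  by apply: I0 (mfg_density S2) (mfg_density S1) _; apply: filterS m12 => x ->.
have l12 : l1 = l2 by lra.
split=> //; apply: (mfg_duality S1 S2).2; lra.
Qed.

(** The constants cancel in the sum of the two inequalities of [mfg_duality], the
    coupling terms have a sign, and what remains is proportional to [eps]. *)
Lemma discounted_selection_le eps u m v mu lambda : 0 < eps ->
  discounted_solution s s' q H f eps u mu -> ergodic_solution s s' q H f v m lambda ->
  \int[torus]_x (u x * m x) - \int[torus]_x u x <=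
  \int[torus]_x (v x * mu x) - \int[torus]_x v x.
Proof.
move=> eps0 /discounted_mfg S1 /ergodic_mfg S2.
have [le12 _] := mfg_duality S1 S2; have [le21 _] := mfg_duality S2 S1.
have [S0 _] := coupling_exchange q_gt1 f_continuous f_increasing f_growth
  (mfg_density S1) (mfg_density S2) (mfg_density_ge0 S1) (mfg_density_ge0 S2).
by rewrite -(ler_pM2l eps0); lra.
Qed.

(** The flux and the Hamilton-Jacobi equality only see the gradient where
    [m > 0]. *)
Lemma ergodic_of_gradient u1 u m p lambda : ergodic_solution s s' q H f u1 m lambda ->
  inL s u -> inL s p -> weak_derivative u p ->
  {ae torus, forall x, 0 < m x -> p x = grad u1 x} ->
  {ae torus, forall x, H x (p x) <= f x (m x) + lambda} ->
  ergodic_solution s s' q H f u m lambda.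
Proof.
move=> [_ mq [m0 m1 fs'] [_ eq] tr] us ps up pp1 lep.
have gp := grad_ae up; have ug := grad_weak up.
have [_ gi] := weak_derivative_integrable ug.
have mm := ((inLP _ _).1 mq).1.
have fluxE : {ae torus, forall x, flux H u1 m x = flux H u m x}.
  apply: filterS3 m0 pp1 gp => x; rewrite /flux le_eqVlt => /predU1P[<-|mx] p1x ->.
    by rewrite !mul0r.
  by rewrite p1x.
have mflux : meas (flux H u m).
  apply: measurable_funM => //.
  exact: measurable_superposition (continuous_Dp H_C1) (integrable_measurable gi).
split.
- by split; [exact: us|exists p].
- exact: mq.
- by split; [exact: m0|exact: m1|exact: inL_ae_eq mflux fluxE fs'].
- split; first by apply: filterS2 gp lep => x ->.
  apply: filterS3 gp pp1 eq => x -> p1x eqx mx.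
  by rewrite p1x// eqx.
move=> phi tphi; have [mf1 _] := (inLP _ _).1 fs'.
transitivity (\int[torus]_x (flux H u1 m x * derive1 phi x)); last exact: tr.
have mphi' := continuous_meas (continuous_derive1_test tphi).
apply: ae_eq_Rintegral.
- exact: measurable_funM mflux mphi'.
- exact: measurable_funM mf1 mphi'.
- by apply: filterS fluxE => x ->.
Qed.

Lemma ergodic_ae_density u m m' lambda : ergodic_solution s s' q H f u m' lambda ->
  inL q m -> {ae torus, forall x, m' x = m x} -> ergodic_solution s s' q H f u m lambda.
Proof.
move=> [us mq' [m0 m1 fs'] [le eq] tr] mq mm'.
have [[mm _] [mm'' _]] := ((inLP _ _).1 mq, (inLP _ _).1 mq').
have [mf1 _] := (inLP _ _).1 fs'.
have fluxE : {ae torus, forall x, flux H u m' x = flux H u m x}.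
  by apply: filterS mm' => x; rewrite /flux => ->.
have /inWP[_ _ ug] := us; have [_ gi] := weak_derivative_integrable ug.
have mflux : meas (flux H u m).
  apply: measurable_funM => //.
  exact: measurable_superposition (continuous_Dp H_C1) (integrable_measurable gi).
split.
- exact: us.
- exact: mq.
- split; first by apply: filterS2 mm' m0 => x ->.
    rewrite -m1; apply: ae_eq_Rintegral; [exact: mm|exact: mm''|].
    by apply: filterS mm' => x ->.
  exact: inL_ae_eq mflux fluxE fs'.
- by split; [apply: filterS2 mm' le|apply: filterS2 mm' eq] => x ->.
move=> phi tphi.
transitivity (\int[torus]_x (flux H u m' x * derive1 phi x)); last exact: tr.
have mphi' := continuous_meas (continuous_derive1_test tphi).
apply: ae_eq_Rintegral.
- exact: measurable_funM mflux mphi'.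
- exact: measurable_funM mf1 mphi'.
- by apply: filterS fluxE => x ->.
Qed.

Lemma selection_pairing m u : inL q m -> \int[torus]_x m x = 1 -> inW s u ->
  selection_functional m u = \int[torus]_x (u x * (m x - 1)).
Proof.
move=> mq m1 us; have qq : q'^-1 + q^-1 = 1 by rewrite addrC.
have uq' := embedding.1 _ us.
have ui := inL_integrable (ltW q'_gt1) uq'; have mi := inL_integrable (ltW q_gt1) mq.
have [umi _] := hoelder_integrable q'0 q0 qq uq' mq.
rewrite selection_functionalE// -RintegralB//.
by apply: eq_Rintegral => x _; ring.
Qed.

Lemma inL_density_sub1 m : inL q m -> inL q (fun x => m x - 1).
Proof.
move=> mq; have := inLD 1 (ltW q_gt1) mq (inL_cst q (-1)).
by congr (inL q _); apply/funext => x; rewrite mul1r.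
Qed.

(** * Uniqueness of the minimiser *)

(** The midpoint [w] of two minimisers is a minimiser, which no competitor
    [w + d * primitive h] improves when [h] is supported where the gradient of
    [w] can move by [d] in both directions. This makes the primitive of [m - 1]
    constant there, hence [m = 1], although the gradients of the two minimisers
    agree on [m > 0]. *)
Lemma argmin_gradient_room u1 u2 m lambda (d : R) : 0 < d ->
  let pw x := 2^-1 * (-1 * grad u1 x + grad u2 x) + grad u1 x in
  argmin_selection s s' q H f m lambda u1 ->
  argmin_selection s s' q H f m lambda u2 ->
  {ae torus, forall x, ~ [/\ grad u1 x <> grad u2 x,
    H x (pw x + d) <= coupling f m x + lambda &
    H x (pw x - d) <= coupling f m x + lambda]}.
Proof.
move=> d0 pw [E1 min1] [E2 min2].
have [_ _ p12] := ergodic_unique E1 E2.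
have [us1 mq [m0 m1 _] [le1 _] _] := E1; have [us2 _ _ [le2 _] _] := E2.
have /inWP[u1s g1s w1] := us1; have /inWP[u2s g2s w2] := us2.
have wpw := weak_derivativeD 2^-1 (weak_derivativeD (-1) w1 w2) w1.
set w := (fun x => 2^-1 * _ + u1 x) in wpw.
have ws : inL s w by exact: inLD (ltW s_gt1) (inLD (-1) (ltW s_gt1) u1s u2s) u1s.
have pws : inL s pw by exact: inLD (ltW s_gt1) (inLD (-1) (ltW s_gt1) g1s g2s) g1s.
have mpw := ((inLP _ _).1 pws).1.
have mg1 := ((inLP _ _).1 g1s).1; have mg2 := ((inLP _ _).1 g2s).1.
have mm := ((inLP _ _).1 mq).1.
have m1q := inL_density_sub1 mq; have m1i := inL_integrable (ltW q_gt1) m1q.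
have mi := inL_integrable (ltW q_gt1) mq.
set g := (fun x => m x - 1) in m1q m1i.
have g0 : \int[torus]_x g x = 0.
  rewrite /g RintegralB//; last exact: integrable_cst.
  by rewrite m1 integral_torus_cst subrr.
pose G := primitive g; have mG : meas G by exact: measurable_primitive.
pose K0 := \int[torus]_x `|g x|.
have GK x : `|G x| <= K0 by exact: primitive_le.
pose B := [set x | [/\ grad u1 x <> grad u2 x, H x (pw x + d) <= coupling f m x + lambda &
    H x (pw x - d) <= coupling f m x + lambda]].
have mB : measurable (B : set (measurableTypeR R)).
  have mF : meas (fun x => coupling f m x + lambda).
    exact: measurable_funD (measurable_coupling f_continuous mm) (measurable_cst _).
  have mH (c : R) : meas (fun x => H x (pw x + c)).
    have mpc := measurable_funD mpw (measurable_cst c).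
    exact: measurable_superposition (continuous_hamiltonian H_C1) mpc.
  rewrite (_ : B = ~` [set x | grad u1 x = grad u2 x] `&`
      [set x | H x (pw x + d) <= coupling f m x + lambda] `&`
      [set x | H x (pw x + (- d)) <= coupling f m x + lambda]); last first.
    by apply/seteqP; split => x [] => [|[]].
  apply: measurableI; last exact: measurable_le_set.
  apply: measurableI; last exact: measurable_le_set.
  apply: measurableC.
  rewrite (_ : [set x | _] = setT `&` (fun x => grad u1 x == grad u2 x) @^-1` [set true]).
    exact: measurable_fun_eqr mg1 mg2 _ _ _.
  by apply/seteqP; split => x /=; [move=> ->; rewrite eqxx|move=> [_ /eqP]].
have indB01 x : \1_B x = 0 :> R \/ (B x /\ \1_B x = 1 :> R).
  rewrite indicE; have [xB|xB] := boolP (x \in B); [right|by left].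
  by split=> //; move: xB; rewrite inE.
have mind : meas (\1_B : R -> R) by exact: measurable_indic.
have iind : int (\1_B : R -> R).
  apply: (integrable_ae_bounded (K := 1) mind); apply: aeW => x.
  by case: (indB01 x) => [|[_]] ->; rewrite ?normr0 ?normr1.
have iBG : int (fun x => \1_B x * G x) by exact: integrable_mul_primitive.
pose b := \int[torus]_x \1_B x.
have [b_eq0|b_neq0] := eqVneq b 0.
  have : {ae torus, forall x, \1_B x = 0 :> R}.
    apply: Rintegral_le0_ae_eq0 => //; last by rewrite -/b b_eq0.
    by apply: aeW => x; case: (indB01 x) => [|[_]] ->.
  apply: filterS => x + Bx; rewrite indicE mem_set//.
  by move=> /eqP; rewrite oner_eq0.
(* On [B] the perturbation is [G] minus its mean [k] over [B], so that it has mean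
   zero and its pairing with [G] is the integral of a square; dividing it by [K]
   makes it at most 1. *)
pose k := (\int[torus]_x (\1_B x * G x)) / b.
pose K := K0 + `|k| + 1.
have K_gt0 : 0 < K.
  by have := GK 0; have := normr_ge0 (G 0); have := normr_ge0 k; rewrite /K; lra.
pose h0 x := \1_B x * G x - k * \1_B x.
have ih0 : int h0 by exact: integrable_sub iBG (integrable_scale k iind).
have h0E x : h0 x = \1_B x * (G x - k) by rewrite /h0; ring.
have h00 : \int[torus]_x h0 x = 0.
  rewrite RintegralB ?RintegralZl//; last exact: integrable_scale.
  by rewrite /k divfK// subrr.
pose h x := K^-1 * h0 x.
have ih : int h by exact: integrable_scale.
have h_mean0 : \int[torus]_x h x = 0 by rewrite RintegralZl// h00 mulr0.
have h_le1 x : `|h x| <= 1.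
  rewrite /h normrM gtr0_norm ?invr_gt0// ler_pdivrMl// mulr1 h0E.
  case: (indB01 x) => [|[_]] ->; first by rewrite mul0r normr0 ltW.
  rewrite mul1r; have := ler_normB (G x) k; have := GK x; rewrite /K; lra.
have hB x : ~ B x -> h x = 0.
  by move=> nBx; rewrite /h h0E; case: (indB01 x) => [|[]//] ->; rewrite mul0r mulr0.
have wh := weak_derivative_primitive ih h_mean0.
have mh := integrable_measurable ih; have mph := measurable_primitive ih.
have wu := weak_derivativeD d wh wpw.
set u := (fun x => d * _ + w x) in wu.
have s0 : 0 < s by exact: lt_trans s_gt1.
have hs : inL s h by apply: (inL_ae_bounded (K := 1) s0 mh); exact: aeW.
have phs : inL s (primitive h).
  apply: (inL_ae_bounded (K := \int[torus]_x `|h x|) s0 mph).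
  by apply: aeW => x; exact: primitive_le.
have us : inL s u by exact: inLD (ltW s_gt1) phs ws.
have ps : inL s (fun x => d * h x + pw x) by exact: inLD (ltW s_gt1) hs pws.
have Eu : ergodic_solution s s' q H f u m lambda.
  apply: (ergodic_of_gradient E1 us ps wu).
    apply: filterS p12 => x p12 mx.
    rewrite hB; last by case=> /(_ (p12 mx)).
    by rewrite mulr0 add0r /pw (p12 mx); ring.
  apply: filterS3 m0 le1 le2 => x m0x le1x le2x.
  have pwle : H x (pw x) <= f x (m x) + lambda.
    have -> : pw x = 2^-1 * grad u1 x + (1 - 2^-1) * grad u2 x by rewrite /pw; field.
    have half : 0 <= (2^-1 : R) <= 1 by rewrite invr_ge0 ler0n invf_le1 ?ler1n.
    have := convex_le_between (grad u1 x) (grad u2 x) (H_convex x) half.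
    by move: le1x le2x; lra.
  have [Bx|nBx] := pselect (B x); last by rewrite hB// mulr0 add0r.
  have [_ lep lem] := Bx; rewrite coupling_pos// in lep lem.
  have h12 : -1 <= h x <= 1 by rewrite -ler_norml.
  (* [d * h x + pw x] is a convex combination of [pw x + d] and [pw x - d]. *)
  pose t := (1 + h x) / 2; have t01 : 0 <= t <= 1 by rewrite /t; move: h12; lra.
  have := convex_le_between (pw x + d) (pw x - d) (H_convex x) t01.
  have -> : t * (pw x + d) + (1 - t) * (pw x - d) = d * h x + pw x by rewrite /t; field.
  by move: t01 lep lem; nra.
have L_lin := (bounded_functional_pairing (ltW s_gt1) q0 q'0 conj_q embedding m1q).1.
have phW : inW s (primitive h) by split=> //; exists h.
have wW : inW s w by split=> //; exists pw.
have JE v : ergodic_solution s s' q H f v m lambda ->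
    selection_functional m v = \int[torus]_x (v x * g x).
  by move=> [vW _ _ _ _]; exact: selection_pairing.
have := min1 _ Eu; have := min1 _ E2; have := min2 _ E1.
rewrite (JE _ E1) (JE _ E2) (JE _ Eu).
rewrite (L_lin d _ _ phW wW) (L_lin 2^-1 _ _ (inWD (-1) (ltW s_gt1) us1 us2) us1).
rewrite (L_lin (-1) _ _ us1 us2) => min21 min12 min1u.
have ihG : int (fun x => h x * G x) by exact: integrable_mul_primitive.
have hG : \int[torus]_x (h x * G x) <= 0.
  have := integral_primitive_by_parts ih m1i; rewrite g0 mulr0 -/G => Lh.
  have dLh : 0 <= d * \int[torus]_x (primitive h x * g x).
    by move: min21 min12 min1u; lra.
  by move: dLh; rewrite pmulr_rge0//; move: Lh; lra.
have h0G : \int[torus]_x (h0 x * (G x - k)) <= 0.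
  have -> : \int[torus]_x (h0 x * (G x - k)) = K * \int[torus]_x (h x * G x).
    transitivity (\int[torus]_x (K * (h x * G x) - k * h0 x)).
      by apply: eq_Rintegral => x _; rewrite /h; field; rewrite gt_eqF.
    rewrite RintegralB ?RintegralZl//; try exact: integrable_scale.
    by rewrite [X in _ - k * X]h00 mulr0 subr0.
  by rewrite pmulr_rle0.
have i0 : int (fun x => h0 x * (G x - k)).
  rewrite (_ : (fun _ => _) = fun x => h0 x * G x - k * h0 x); last first.
    by apply/funext => x; ring.
  by apply: integrable_sub (integrable_mul_primitive ih0 m1i) (integrable_scale k ih0).
have sq x : h0 x * (G x - k) = \1_B x * (G x - k) ^+ 2 by rewrite h0E; ring.
have h0Gz : {ae torus, forall x, h0 x * (G x - k) = 0}.
  apply: (Rintegral_le0_ae_eq0 i0 _ h0G); apply: aeW => x.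
  by rewrite sq mulr_ge0 ?sqr_ge0.
apply: filterS3 h0Gz (primitive_level_ae k m1i) p12 => x h0x lev p12x Bx.
move: h0x; rewrite sq; case: (indB01 x) => [|[_ ->]].
  by rewrite indicE mem_set// => /eqP; rewrite oner_eq0.
rewrite mul1r => /eqP; rewrite expf_eq0/= subr_eq0 => /eqP /lev /eqP.
rewrite subr_eq0 => /eqP mx; have [+ _ _] := Bx; apply; apply: p12x.
by rewrite mx.
Qed.

(** Where the gradients differ, the Hamilton-Jacobi inequality is strict at their
    midpoint, which leaves the room excluded by [argmin_gradient_room]. *)
Lemma argmin_gradient_unique u1 u2 m lambda :
  argmin_selection s s' q H f m lambda u1 ->
  argmin_selection s s' q H f m lambda u2 ->
  {ae torus, forall x, grad u1 x = grad u2 x}.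
Proof.
move=> A1 A2; have [[_ _ [m0 _ _] [le1 _] _] _] := A1.
have [[_ _ _ [le2 _] _] _] := A2.
have n0 n : (0 : R) < n.+1%:R^-1 by rewrite invr_gt0.
have room := ae_foralln (fun n => argmin_gradient_room (n0 n) A1 A2).
apply: filterS2 room (filterI m0 (filterI le1 le2)) => x room [m0x [le1x le2x]].
apply: contrapT => p12; pose pw := 2^-1 * (-1 * grad u1 x + grad u2 x) + grad u1 x.
rewrite -(coupling_pos f m0x) in le1x le2x.
have Hpw : H x pw < coupling f m x + lambda.
  have -> : pw = 2^-1 * grad u1 x + (1 - 2^-1) * grad u2 x by rewrite /pw; field.
  have half : 0 < (2^-1 : R) < 1 by rewrite invr_gt0 ltr0n invf_lt1 ?ltr1n.
  have /eqP p12' := p12.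
  by have := H_convex x p12' half; lra.
have cH : {for pw, continuous (H x)}.
  by apply: differentiable_continuous; apply/derivable1_diffP; exact: derivable_hamiltonian.
have [e /= e0 He] : \forall y \near pw, H x y < coupling f m x + lambda by exact: cvgr_lt cH _ Hpw.
have [n ne] : exists n, n.+1%:R^-1 < e.
  exists (Num.truncn e^-1); rewrite invf_plt ?posrE ?ltr0Sn//.
  by rewrite truncnS_gt.
apply: (room n); split => //; apply/ltW/He; rewrite /= /ball_.
  by rewrite opprD addNKr normrN gtr0_norm.
by rewrite opprB addrC subrK gtr0_norm.
Qed.

Lemma argmin_unique u1 u2 m lambda :
  argmin_selection s s' q H f m lambda u1 ->
  argmin_selection s s' q H f m lambda u2 ->
  \int[torus]_x u1 x = 0 -> \int[torus]_x u2 x = 0 ->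
  {ae torus, forall x, u1 x = u2 x}.
Proof.
move=> A1 A2 m1 m2; have g12 := argmin_gradient_unique A1 A2.
have [[/inWP[_ _ w1] _ _ _ _] _] := A1; have [[/inWP[_ _ w2] _ _ _ _] _] := A2.
have [i1 _] := weak_derivative_integrable w1; have [i2 _] := weak_derivative_integrable w2.
have z : {ae torus, forall x, -1 * grad u1 x + grad u2 x = 0}.
  by apply: filterS g12 => x ->; ring.
apply: filterS (weak_derivative_eq0 (weak_derivativeD (-1) w1 w2) z) => x.
rewrite RintegralD//; last exact: integrable_scale.
by rewrite RintegralZl// m1 m2 mulr0 addr0 mulN1r addrC => /eqP; rewrite subr_eq0 eq_sym => /eqP.
Qed.

(** * Limits of discounted solutions *)

Lemma integral_centered u : int u -> \int[torus]_x centered u x = 0.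
Proof.
move=> ui; rewrite /centered RintegralB//; last exact: integrable_cst.
by rewrite integral_torus_cst subrr.
Qed.

(** Passing to the limit in [discounted_selection_le], whose two sides are
    bounded functionals of [centered u] and of the discounted density. *)
Lemma discounted_limit_argmin (eps : R^nat) (U M : nat -> R -> R) u m ubar mbar lambda lbar :
  (forall n, 0 < eps n) ->
  (forall n, discounted_solution s s' q H f (eps n) (U n) (M n)) ->
  inL q m -> ergodic_solution s s' q H f u m lambda ->
  ergodic_solution s s' q H f ubar mbar lbar ->
  weak_cvgW s \oo (fun n => centered (U n)) ubar -> weak_cvgL q \oo M mbar ->
  argmin_selection s s' q H f m lambda ubar /\ \int[torus]_x ubar x = 0.
Proof.
move=> eps0 UM mq E Ebar Ucvg Mcvg.
have [mm l12 _] := ergodic_unique Ebar E.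
have Eu : ergodic_solution s s' q H f ubar m lambda.
  rewrite -l12; exact: ergodic_ae_density Ebar mq mm.
have [uW mbq _ _ _] := Ebar; have [_ _ [_ m1 _] _ _] := E.
have UW n : inW s (U n) by have [] := UM n.
have cUW n : inW s (centered (U n)) by exact: inW_centered (ltW s_gt1) (UW n).
have W_int v : inW s v -> int v.
  by move=> /embedding.1; exact: inL_integrable (ltW q'_gt1).
have pair1 := bounded_functional_pairing (ltW s_gt1) q0 q'0 conj_q embedding (inL_cst q 1).
have int_ubar : \int[torus]_x ubar x = 0.
  have := Ucvg _ pair1.
  rewrite (_ : (fun n => _) = cst 0); last first.
    apply/funext => n; rewrite -[RHS](integral_centered (W_int _ (UW n))).
    by apply: eq_Rintegral => x _; rewrite mulr1.
  move=> /(cvg_lim (@Rhausdorff R)); rewrite lim_cst; last exact: Rhausdorff.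
  by move=> e; rewrite [RHS]e; apply: eq_Rintegral => x _; rewrite mulr1.
split; last exact: int_ubar.
split=> [|v Ev]; first exact: Eu.
have [vW _ _ _ _] := Ev.
have qq : q'^-1 + q^-1 = 1 by rewrite addrC.
have vq' := embedding.1 _ vW; have vi := W_int _ vW.
have mi := inL_integrable (ltW q_gt1) mq.
have mul_int w : inW s w -> int (fun x => w x * m x).
  by move=> /embedding.1 wq; have [] := hoelder_integrable q'0 q0 qq wq mq.
have pair_m := bounded_functional_pairing (ltW s_gt1) q0 q'0 conj_q embedding
  (inL_density_sub1 mq).
have lhs := Ucvg _ pair_m.
have rhs := Mcvg _ (bounded_functional_pairingL q0 q'0 conj_q vq').
have := ler_cvg_to lhs (cvgB rhs (cvg_cst (\int[torus]_x v x))).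
rewrite (selection_pairing mq m1 uW) (selection_functionalE vi (mul_int _ vW) mi m1).
have -> : \int[torus]_x (v x * m x) = \int[torus]_x (mbar x * v x).
  have mv := integrable_measurable vi; have mmb := ((inLP _ _).1 mbq).1.
  apply: ae_eq_Rintegral; first exact: integrable_measurable (mul_int _ vW).
    exact: measurable_funM mmb mv.
  by apply: filterS mm => x ->; rewrite mulrC.
apply; apply: nearW => n.
have := discounted_selection_le (eps0 n) (UM n) Ev.
rewrite -(selection_functionalE (W_int _ (UW n)) (mul_int _ (UW n)) mi m1) => le.
have vM : \int[torus]_x (M n x * v x) = \int[torus]_x (v x * M n x).
  by apply: eq_Rintegral => x _; rewrite mulrC.
rewrite -vM in le.
apply: le_trans le; rewrite le_eqVlt; apply/orP; left; apply/eqP.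
rewrite -(selection_pairing mq m1 (cUW n)) /selection_functional.
apply: eq_Rintegral => x _; rewrite {1}/centered.
by rewrite integral_centered ?subr0//; exact: W_int.
Qed.
End mean_field_games.

Unset Implicit Arguments.

Theorem corollary4p4 (R : realType) (s s' q q' : R)
  (s_gt1 : 1 < s) (q_gt1 : 1 < q)
  (conj_s : s^-1 + s'^-1 = 1) (conj_q : q^-1 + q'^-1 = 1)
  (embedding : sobolev_embedding s q')
  (H : R -> R -> R)
  (H_periodic : periodic1 H)
  (H_C1 : class_C1 (fun z : R * R => H z.1 z.2))
  (H_convex : forall x, strictly_convex (H x))
  (H_coercive : uniformly_coercive H)
  (f : R -> R -> R)
  (f_periodic : forall r, 0 <= r -> periodic1 (f^~ r))
  (f_continuous : {within [set z : R * R | 0 <= z.2],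
                     continuous (fun z : R * R => f z.1 z.2)})
  (f_increasing : forall x r1 r2, 0 <= r1 -> r1 < r2 -> f x r1 < f x r2)
  (f_growth : exists2 C : R, 0 < C &
     forall x r, 0 <= r -> `|f x r| <= C * (1 + r `^ (q - 1)))
  (m : R -> R) (lambda : R)
  (m_lambda_ergodic : ergodic_pair s s' q H f m lambda)
  (U M : R -> R -> R)
  (UM_discounted : forall eps, 0 < eps ->
     discounted_solution s s' q H f eps (U eps) (M eps))
  (UM_compact : compact_stable s s' q H f U M) :
  exists ustar : R -> R,
    [/\ argmin_selection s s' q H f m lambda ustar,
        \int[torus_measure]_x ustar x = 0,
        forall v, argmin_selection s s' q H f m lambda v ->
          \int[torus_measure]_x v x = 0 -> v = ustar %[ae torus_measure] &
        weak_cvgW s 0^'+ (fun eps => centered (U eps)) ustar].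
Proof.
have [mq [u0 E0]] := m_lambda_ergodic.
pose limit v := argmin_selection s s' q H f m lambda v /\
  \int[torus_measure]_x v x = 0.
have cluster (eps : R^nat) : (forall n, 0 < eps n) -> eps n @[n --> \oo] --> 0 ->
    exists (k : nat -> nat) (v : R -> R), limit v /\
      weak_cvgW s \oo (fun n => centered (U (eps (k n)))) v.
  move=> eps_gt0 eps0.
  have [k [_ [v [mbar [lbar [Ev Ucvg Mcvg _]]]]]] := UM_compact eps eps_gt0 eps0.
  exists k, v; split; last exact: Ucvg.
  exact: (discounted_limit_argmin s_gt1 q_gt1 conj_s conj_q embedding H_C1 H_convex
    f_continuous f_increasing f_growth (fun n => eps_gt0 (k n))
    (fun n => UM_discounted _ (eps_gt0 (k n))) mq E0 Ev Ucvg Mcvg).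
have limit_unique v w : limit v -> limit w ->
    {ae torus_measure, forall x, v x = w x}.
  move=> [Av v0] [Aw w0].
  exact: (argmin_unique s_gt1 q_gt1 conj_s conj_q embedding H_C1 H_convex
    f_continuous f_increasing f_growth Av Aw v0 w0).
have inv_gt0 n : (0 : R) < n.+1%:R^-1 by rewrite invr_gt0.
have [k0 [ustar [[Astar int_star] _]]] := cluster _ inv_gt0 cvg_harmonic.
exists ustar; split; [exact: Astar|exact: int_star| |].
  move=> v Av int_v; have := limit_unique _ _ (conj Av int_v) (conj Astar int_star).
  by apply: filterS => x vx _.
move=> L bL; apply/cvgrPdist_lt => e e0; apply: contrapT => far.
(* A sequence along which [L] stays away from its expected limit would have a
   subsequence converging weakly to another mean-zero minimiser. *)
have /choice[eps eps_far] : forall n : nat, exists x : R,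
    [/\ 0 < x, x < n.+1%:R^-1 & e <= `|L ustar - L (centered (U x))|].
  move=> n; apply: contrapT => near_n; apply: far.
  exists n.+1%:R^-1 => [|x /= xn x0]; first by rewrite /= invr_gt0.
  rewrite ltNge; apply/negP => ex; apply: near_n; exists x; split=> //.
  by rewrite sub0r normrN gtr0_norm in xn.
have eps_gt0 n : 0 < eps n by have [] := eps_far n.
have eps0 : eps n @[n --> \oo] --> 0.
  apply: (@squeeze_cvgr _ _ _ _ (cst 0) (fun n => n.+1%:R^-1)).
  - by apply: nearW => n; have [x0 xn _] := eps_far n; rewrite /= !ltW.
  - exact: cvg_cst.
  - exact: cvg_harmonic.
have [k [v [[Av int_v] vcvg]]] := cluster eps eps_gt0 eps0.
have Lv : L v = L ustar.
  apply: (bounded_functional_ae_eq (ltW s_gt1) bL).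
  - by have [[vW _ _ _ _] _] := Av.
  - by have [[vW _ _ _ _] _] := Astar.
  - exact: limit_unique (conj Av int_v) (conj Astar int_star).
have := vcvg L bL; rewrite Lv => /cvgrPdist_lt /(_ e e0) [N _ /(_ N (leqnn N))] /=.
by apply/negP; rewrite -leNgt; have [] := eps_far (k N).
Qed.
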